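(* Consider a functional pure type system specification $(\mathcal S,\mathcal A,\mathcal R)$, its explicitly-typed pure type system (EPTS) and its Dedukti encoding $(\Sigma_{EPTS},\mathscr R_{EPTS})$ with translation $[\![-]\!]$. Let $\Gamma$ be an EPTS context and $M,A$ EPTS terms. (1) If $\Gamma$ is well-formed then $[\![\Gamma]\!]$ is well-formed in Dedukti (in signature $\Sigma_{EPTS}$). (2) If $\Gamma\vdash M:A$, then: if $A$ is a top-sort, $[\![\Gamma]\!]\vdash_{DK}[\![M]\!]:\mathbf U_A$; otherwise $[\![\Gamma]\!]\vdash_{DK}[\![M]\!]:\mathbf{El}_{s_A}\,[\![A]\!]$, where $s_A$ is the sort with $\Gamma\vdash A:s_A$.
   Context: A functional PTS specification consists of a set of sorts $\mathcal S$, $\mathcal A\subseteq\mathcal S^2$ and $\mathcal R\subseteq\mathcal S^3$, with $\mathcal A$ functional and $\mathcal R$ functional in its first two components. A sort $s$ is a top-sort if there is no $s'$ with $(s,s')\in\mathcal A$. EPTS terms: $M::=x\mid s\mid\Pi_{s_1,s_2}(A,x.B)\mid\lambda_{s_1,s_2}(A,x.B,x.M)\mid @_{s_1,s_2}(A,x.B,M,N)$ ($x$ bound in $B$ and in the body $M$). EPTS reduction is the context closure of $@_{s_1,s_2}(A,x.B,\lambda_{s_1,s_2}(A',x.B',x.M),N)\hookrightarrow M\{N/x\}$ for $(s_1,s_2,s_3)\in\mathcal R$, and $\equiv$ the generated equivalence. EPTS typing: $-$ is well-formed; if $\Gamma\vdash A:s$ and $x\notin\Gamma$ then $\Gamma,x:A$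 is well-formed; (Conv) $\Gamma\vdash M:A$, $\Gamma\vdash B:s$, $A\equiv B$ give $\Gamma\vdash M:B$; (Sort) $\Gamma$ well-formed and $(s_1,s_2)\in\mathcal A$ give $\Gamma\vdash s_1:s_2$; (Var) $\Gamma$ well-formed and $x:A\in\Gamma$ give $\Gamma\vdash x:A$; for $(s_1,s_2,s_3)\in\mathcal R$: (Prod) $\Gamma\vdash A:s_1$, $\Gamma,x:A\vdash B:s_2$ give $\Gamma\vdash\Pi_{s_1,s_2}(A,x.B):s_3$; (Abs) additionally $\Gamma,x:A\vdash M:B$ gives $\Gamma\vdash\lambda_{s_1,s_2}(A,x.B,x.M):\Pi_{s_1,s_2}(A,x.B)$; (App) $\Gamma\vdash A:s_1$, $\Gamma,x:A\vdash B:s_2$, $\Gamma\vdash N:A$, $\Gamma\vdash M:\Pi_{s_1,s_2}(A,x.B)$ give $\Gamma\vdash @_{s_1,s_2}(A,x.B,M,N):B\{N/x\}$. Since the system is functional, the sort of a type in a context is unique. Dedukti: terms $x\mid c[\vec M]\mid\mathtt{TYPE}\mid\mathtt{KIND}\mid MN\mid\lambda x:A.M\mid\Pi x:A.B$ with constants of fixed arity (written $c\,\vec M$); typing is the $\lambda\Pi$-calculus with constants declared $c[\Delta]:A$ in a signature and typed by $\Sigma;\Gamma\vdash c[\vec M]:A\{\vec M\}$ when $\vec M$ instantiates $\Delta$, with conversion modulo $\beta$ and the rewrite rules. The theory $(\Sigma_{EPTS},\mathscr R_{EPTS})$: for $s\in\mathcal S$, $\mathbf U_s:\mathtt{TYPE}$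 and $\mathbf{El}_s[A:\mathbf U_s]:\mathtt{TYPE}$; for $(s_1,s_2)\in\mathcal A$, $\mathbf u_{s_1}:\mathbf U_{s_2}$ and the rule $\mathbf{El}_{s_2}\,\mathbf u_{s_1}\hookrightarrow\mathbf U_{s_1}$; for $(s_1,s_2,s_3)\in\mathcal R$: $\mathbf{Prod}_{s_1,s_2}[A:\mathbf U_{s_1};B:\mathbf{El}_{s_1}A\to\mathbf U_{s_2}]:\mathbf U_{s_3}$, $\mathbf{abs}_{s_1,s_2}[A:\mathbf U_{s_1};B:\mathbf{El}_{s_1}A\to\mathbf U_{s_2};M:\Pi x:\mathbf{El}_{s_1}A.\mathbf{El}_{s_2}(B\,x)]:\mathbf{El}_{s_3}(\mathbf{Prod}_{s_1,s_2}A\,B)$, $\mathbf{app}_{s_1,s_2}[A:\mathbf U_{s_1};B:\mathbf{El}_{s_1}A\to\mathbf U_{s_2};M:\mathbf{El}_{s_3}(\mathbf{Prod}_{s_1,s_2}A\,B);N:\mathbf{El}_{s_1}A]:\mathbf{El}_{s_2}(B\,N)$, and the rule $\mathbf{app}_{s_1,s_2}\,A\,B\,(\mathbf{abs}_{s_1,s_2}\,A'\,B'\,M)\,N\hookrightarrow M\,N$. $\Gamma\vdash_{DK}M:A$ means $\Sigma_{EPTS};\Gamma\vdash M:A$ in this theory. Translation: $[\![x]\!]=x$, $[\![s]\!]=\mathbf u_s$, $[\![\Pi_{s_1,s_2}(A,x.B)]\!]=\mathbf{Prod}_{s_1,s_2}[\![A]\!](\lambda x:\mathbf{El}_{s_1}[\![A]\!].[\![B]\!])$,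 $[\![\lambda_{s_1,s_2}(A,x.B,x.M)]\!]=\mathbf{abs}_{s_1,s_2}[\![A]\!](\lambda x:\mathbf{El}_{s_1}[\![A]\!].[\![B]\!])(\lambda x:\mathbf{El}_{s_1}[\![A]\!].[\![M]\!])$, $[\![@_{s_1,s_2}(A,x.B,M,N)]\!]=\mathbf{app}_{s_1,s_2}[\![A]\!](\lambda x:\mathbf{El}_{s_1}[\![A]\!].[\![B]\!])[\![M]\!][\![N]\!]$; on well-formed contexts $[\![-]\!]=-$ and $[\![\Gamma,x:A]\!]=[\![\Gamma]\!],x:\mathbf{El}_{s_A}[\![A]\!]$ where $\Gamma\vdash A:s_A$. *)

(* Defs.v *)
(* Both calculi are represented with de Bruijn indices; in every
   context (a list of types) the most recently declared variable comes first,
   so that the freshness conditions on variables disappear. *)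
From Stdlib Require Import List Relations.
From Stdlib Require Vector Fin.
Import Vector.VectorNotations.

Record pts_spec : Type := PTSSpec {
  sort : Type;
  axm : sort -> sort -> Prop;
  rul : sort -> sort -> sort -> Prop
}.

Definition functional_pts (P : pts_spec) : Prop :=
  (forall s s1 s2, axm P s s1 -> axm P s s2 -> s1 = s2) /\
  (forall s1 s2 s3 s4, rul P s1 s2 s3 -> rul P s1 s2 s4 -> s3 = s4).

Definition top_sort (P : pts_spec) (s : sort P) : Prop :=
  ~ exists s', axm P s s'.

(* [ePi s1 s2 A B], [eLam s1 s2 A B M] and [eApp s1 s2 A B M N] stand for
   Pi_{s1,s2}(A, x.B), lambda_{s1,s2}(A, x.B, x.M) and @_{s1,s2}(A, x.B, M, N):
   one variable is bound in each [B] and in the body [M] of [eLam]. *)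
Inductive eterm (S : Type) : Type :=
| eVar (n : nat)
| eSort (s : S)
| ePi (s1 s2 : S) (A B : eterm S)
| eLam (s1 s2 : S) (A B M : eterm S)
| eApp (s1 s2 : S) (A B M N : eterm S).

Arguments eVar {S} n.
Arguments eSort {S} s.
Arguments ePi {S} s1 s2 A B.
Arguments eLam {S} s1 s2 A B M.
Arguments eApp {S} s1 s2 A B M N.

Definition upren (r : nat -> nat) (n : nat) : nat :=
  match n with 0 => 0 | S m => S (r m) end.

Fixpoint eren {S : Type} (r : nat -> nat) (M : eterm S) : eterm S :=
  match M with
  | eVar n => eVar (r n)
  | eSort s => eSort s
  | ePi s1 s2 A B => ePi s1 s2 (eren r A) (eren (upren r) B)
  | eLam s1 s2 A B M =>
      eLam s1 s2 (eren r A) (eren (upren r) B) (eren (upren r) M)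
  | eApp s1 s2 A B M N =>
      eApp s1 s2 (eren r A) (eren (upren r) B) (eren r M) (eren r N)
  end.

Definition eup {S : Type} (f : nat -> eterm S) (n : nat) : eterm S :=
  match n with 0 => eVar 0 | Datatypes.S m => eren Datatypes.S (f m) end.

Fixpoint esubst {S : Type} (f : nat -> eterm S) (M : eterm S) : eterm S :=
  match M with
  | eVar n => f n
  | eSort s => eSort s
  | ePi s1 s2 A B => ePi s1 s2 (esubst f A) (esubst (eup f) B)
  | eLam s1 s2 A B M =>
      eLam s1 s2 (esubst f A) (esubst (eup f) B) (esubst (eup f) M)
  | eApp s1 s2 A B M N =>
      eApp s1 s2 (esubst f A) (esubst (eup f) B) (esubst f M) (esubst f N)
  end.

(* M{N/x}, where x is the variable 0 of M. *)
Definition esubst1 {S : Type} (N M : eterm S) : eterm S :=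
  esubst (fun n => match n with 0 => N | Datatypes.S m => eVar m end) M.

Inductive ered (P : pts_spec) : eterm (sort P) -> eterm (sort P) -> Prop :=
| ered_beta s1 s2 s3 A B A' B' M N :
    rul P s1 s2 s3 ->
    ered P (eApp s1 s2 A B (eLam s1 s2 A' B' M) N) (esubst1 N M)
| ered_pi1 s1 s2 A A' B :
    ered P A A' -> ered P (ePi s1 s2 A B) (ePi s1 s2 A' B)
| ered_pi2 s1 s2 A B B' :
    ered P B B' -> ered P (ePi s1 s2 A B) (ePi s1 s2 A B')
| ered_lam1 s1 s2 A A' B M :
    ered P A A' -> ered P (eLam s1 s2 A B M) (eLam s1 s2 A' B M)
| ered_lam2 s1 s2 A B B' M :
    ered P B B' -> ered P (eLam s1 s2 A B M) (eLam s1 s2 A B' M)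
| ered_lam3 s1 s2 A B M M' :
    ered P M M' -> ered P (eLam s1 s2 A B M) (eLam s1 s2 A B M')
| ered_app1 s1 s2 A A' B M N :
    ered P A A' -> ered P (eApp s1 s2 A B M N) (eApp s1 s2 A' B M N)
| ered_app2 s1 s2 A B B' M N :
    ered P B B' -> ered P (eApp s1 s2 A B M N) (eApp s1 s2 A B' M N)
| ered_app3 s1 s2 A B M M' N :
    ered P M M' -> ered P (eApp s1 s2 A B M N) (eApp s1 s2 A B M' N)
| ered_app4 s1 s2 A B M N N' :
    ered P N N' -> ered P (eApp s1 s2 A B M N) (eApp s1 s2 A B M N').

Definition econv (P : pts_spec) : eterm (sort P) -> eterm (sort P) -> Prop :=
  clos_refl_sym_trans _ (ered P).

Definition ectx (P : pts_spec) : Type := list (eterm (sort P)).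

Inductive ewf (P : pts_spec) : ectx P -> Prop :=
| ewf_nil : ewf P nil
| ewf_cons G A s :
    ety P G A (eSort s) -> ewf P (cons A G)
with ety (P : pts_spec) : ectx P -> eterm (sort P) -> eterm (sort P) -> Prop :=
| ety_conv G M A B s :
    ety P G M A -> ety P G B (eSort s) -> econv P A B -> ety P G M B
| ety_sort G s1 s2 :
    ewf P G -> axm P s1 s2 -> ety P G (eSort s1) (eSort s2)
| ety_var G n A :
    ewf P G -> nth_error G n = Some A ->
    ety P G (eVar n) (eren (fun m => m + S n) A)
| ety_pi G s1 s2 s3 A B :
    rul P s1 s2 s3 ->
    ety P G A (eSort s1) -> ety P (cons A G) B (eSort s2) ->
    ety P G (ePi s1 s2 A B) (eSort s3)
| ety_lam G s1 s2 s3 A B M :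
    rul P s1 s2 s3 ->
    ety P G A (eSort s1) -> ety P (cons A G) B (eSort s2) ->
    ety P (cons A G) M B ->
    ety P G (eLam s1 s2 A B M) (ePi s1 s2 A B)
| ety_app G s1 s2 s3 A B M N :
    rul P s1 s2 s3 ->
    ety P G A (eSort s1) -> ety P (cons A G) B (eSort s2) ->
    ety P G N A -> ety P G M (ePi s1 s2 A B) ->
    ety P G (eApp s1 s2 A B M N) (esubst1 N B).

Inductive dsort : Type := TYPE | KIND.

(* Constants have a fixed arity and are fully applied: [dCst c v] is c[v]. *)
Inductive dterm {C : Type} (ar : C -> nat) : Type :=
| dVar (n : nat)
| dCst (c : C) (v : Vector.t (dterm ar) (ar c))
| dSort (s : dsort)
| dApp (M N : dterm ar)
| dLam (A M : dterm ar)
| dPi (A B : dterm ar).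

Arguments dVar {C ar} n.
Arguments dCst {C ar} c v.
Arguments dSort {C ar} s.
Arguments dApp {C ar} M N.
Arguments dLam {C ar} A M.
Arguments dPi {C ar} A B.

Fixpoint dren {C : Type} {ar : C -> nat} (r : nat -> nat) (M : dterm ar)
  : dterm ar :=
  match M with
  | dVar n => dVar (r n)
  | dCst c v => dCst c (Vector.map (dren r) v)
  | dSort s => dSort s
  | dApp M N => dApp (dren r M) (dren r N)
  | dLam A M => dLam (dren r A) (dren (upren r) M)
  | dPi A B => dPi (dren r A) (dren (upren r) B)
  end.

Definition dup {C : Type} {ar : C -> nat} (f : nat -> dterm ar) (n : nat)
  : dterm ar :=
  match n with 0 => dVar 0 | S m => dren S (f m) end.

Fixpoint dsubst {C : Type} {ar : C -> nat} (f : nat -> dterm ar) (M : dterm ar)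
  : dterm ar :=
  match M with
  | dVar n => f n
  | dCst c v => dCst c (Vector.map (dsubst f) v)
  | dSort s => dSort s
  | dApp M N => dApp (dsubst f M) (dsubst f N)
  | dLam A M => dLam (dsubst f A) (dsubst (dup f) M)
  | dPi A B => dPi (dsubst f A) (dsubst (dup f) B)
  end.

(* M{l}: simultaneous substitution of the variables 0, ..., length l - 1 of M
   by the elements of l. *)
Definition dsubstl {C : Type} {ar : C -> nat} (l : list (dterm ar))
  (M : dterm ar) : dterm ar :=
  dsubst (fun n => match nth_error l n with
                   | Some N => N
                   | None => dVar (n - length l)
                   end) M.

Definition dsubst1 {C : Type} {ar : C -> nat} (N M : dterm ar) : dterm ar :=
  dsubstl (cons N nil) M.

(* [dsig T c D A] means that the declaration c[D] : A is in the signature.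
   [drule T l r] means that l --> r is a rewrite rule, whose pattern variables
   are the free variables of l. *)
Record dtheory {C : Type} (ar : C -> nat) : Type := DTheory {
  dsig : C -> list (dterm ar) -> dterm ar -> Prop;
  drule : dterm ar -> dterm ar -> Prop
}.

Arguments dsig {C ar} d _ _ _.
Arguments drule {C ar} d _ _.
Arguments DTheory {C ar} dsig drule.

Inductive dred {C : Type} {ar : C -> nat} (T : dtheory ar)
  : dterm ar -> dterm ar -> Prop :=
| dred_beta A M N : dred T (dApp (dLam A M) N) (dsubst1 N M)
| dred_rule l r f : drule T l r -> dred T (dsubst f l) (dsubst f r)
| dred_cst c (v : Vector.t (dterm ar) (ar c)) (i : Fin.t (ar c)) M :
    dred T (Vector.nth v i) M -> dred T (dCst c v) (dCst c (Vector.replace v i M))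
| dred_app1 M M' N : dred T M M' -> dred T (dApp M N) (dApp M' N)
| dred_app2 M N N' : dred T N N' -> dred T (dApp M N) (dApp M N')
| dred_lam1 A A' M : dred T A A' -> dred T (dLam A M) (dLam A' M)
| dred_lam2 A M M' : dred T M M' -> dred T (dLam A M) (dLam A M')
| dred_pi1 A A' B : dred T A A' -> dred T (dPi A B) (dPi A' B)
| dred_pi2 A B B' : dred T B B' -> dred T (dPi A B) (dPi A B').

Definition dconv {C : Type} {ar : C -> nat} (T : dtheory ar)
  : dterm ar -> dterm ar -> Prop :=
  clos_refl_sym_trans _ (dred T).

(* [dinst T G l D] is the judgement G |- l : D that l instantiates D; like the
   context D, the list l has its last component first, hence the [rev] in
   [dty_cst].  The premise D |- A : s of [dty_cst] is what makes a constant
   usable only when its declaration is itself well-typed in the signature. *)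
Inductive dwf {C : Type} {ar : C -> nat} (T : dtheory ar)
  : list (dterm ar) -> Prop :=
| dwf_nil : dwf T nil
| dwf_cons G A :
    dty T G A (dSort TYPE) -> dwf T (cons A G)
with dty {C : Type} {ar : C -> nat} (T : dtheory ar)
  : list (dterm ar) -> dterm ar -> dterm ar -> Prop :=
| dty_conv G M A B s :
    dty T G M A -> dty T G B (dSort s) -> dconv T A B -> dty T G M B
| dty_sort G :
    dwf T G -> dty T G (dSort TYPE) (dSort KIND)
| dty_var G n A :
    dwf T G -> nth_error G n = Some A ->
    dty T G (dVar n) (dren (fun m => m + S n) A)
| dty_cst G c (v : Vector.t (dterm ar) (ar c)) D A s :
    dsig T c D A -> dty T D A (dSort s) ->
    dinst T G (rev (Vector.to_list v)) D ->
    dty T G (dCst c v) (dsubstl (rev (Vector.to_list v)) A)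
| dty_pi G A B s :
    dty T G A (dSort TYPE) -> dty T (cons A G) B (dSort s) ->
    dty T G (dPi A B) (dSort s)
| dty_lam G A B M s :
    dty T G A (dSort TYPE) -> dty T (cons A G) B (dSort s) ->
    dty T (cons A G) M B ->
    dty T G (dLam A M) (dPi A B)
| dty_app G A B M N :
    dty T G M (dPi A B) -> dty T G N A ->
    dty T G (dApp M N) (dsubst1 N B)
with dinst {C : Type} {ar : C -> nat} (T : dtheory ar)
  : list (dterm ar) -> list (dterm ar) -> list (dterm ar) -> Prop :=
| dinst_nil G :
    dwf T G -> dinst T G nil nil
| dinst_cons G l D N A :
    dinst T G l D -> dty T G N (dsubstl l A) ->
    dinst T G (cons N l) (cons A D).

(* The names of the constants.  Only those declared by [epts_sig] are in the
   signature; e.g. the name u_s exists for a top-sort s, because the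
   translation is defined on all raw terms, but it is not declared. *)
Inductive epts_cst (S : Type) : Type :=
| cU (s : S)
| cEl (s : S)
| cu (s : S)
| cProd (s1 s2 : S)
| cabs (s1 s2 : S)
| capp (s1 s2 : S).

Arguments cU {S} s.
Arguments cEl {S} s.
Arguments cu {S} s.
Arguments cProd {S} s1 s2.
Arguments cabs {S} s1 s2.
Arguments capp {S} s1 s2.

Definition epts_ar {S : Type} (c : epts_cst S) : nat :=
  match c with
  | cU _ => 0
  | cEl _ => 1
  | cu _ => 0
  | cProd _ _ => 2
  | cabs _ _ => 3
  | capp _ _ => 4
  end.

Definition dkterm (S : Type) : Type := dterm (@epts_ar S).

Definition dU {S : Type} (s : S) : dkterm S := dCst (cU s) []%vector.
Definition dEl {S : Type} (s : S) (A : dkterm S) : dkterm S :=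
  dCst (cEl s) [A]%vector.
Definition du {S : Type} (s : S) : dkterm S := dCst (cu s) []%vector.
Definition dProd {S : Type} (s1 s2 : S) (A B : dkterm S) : dkterm S :=
  dCst (cProd s1 s2) [A; B]%vector.
Definition dabs {S : Type} (s1 s2 : S) (A B M : dkterm S) : dkterm S :=
  dCst (cabs s1 s2) [A; B; M]%vector.
Definition dapp {S : Type} (s1 s2 : S) (A B M N : dkterm S) : dkterm S :=
  dCst (capp s1 s2) [A; B; M; N]%vector.

(* The parameter contexts below are written from right to left:
   A, then B, then M, then N. *)
Inductive epts_sig (P : pts_spec)
  : epts_cst (sort P) -> list (dkterm (sort P)) -> dkterm (sort P) -> Prop :=
| sig_U s : epts_sig P (cU s) nil (dSort TYPE)
| sig_El s : epts_sig P (cEl s) (dU s :: nil)%list (dSort TYPE)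
| sig_u s1 s2 : axm P s1 s2 -> epts_sig P (cu s1) nil (dU s2)
| sig_Prod s1 s2 s3 :
    rul P s1 s2 s3 ->
    epts_sig P (cProd s1 s2)
      (dPi (dEl s1 (dVar 0)) (dU s2) :: dU s1 :: nil)%list
      (dU s3)
| sig_abs s1 s2 s3 :
    rul P s1 s2 s3 ->
    epts_sig P (cabs s1 s2)
      (dPi (dEl s1 (dVar 1)) (dEl s2 (dApp (dVar 1) (dVar 0)))
       :: dPi (dEl s1 (dVar 0)) (dU s2) :: dU s1 :: nil)%list
      (dEl s3 (dProd s1 s2 (dVar 2) (dVar 1)))
| sig_app s1 s2 s3 :
    rul P s1 s2 s3 ->
    epts_sig P (capp s1 s2)
      (dEl s1 (dVar 2)
       :: dEl s3 (dProd s1 s2 (dVar 1) (dVar 0))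
       :: dPi (dEl s1 (dVar 0)) (dU s2) :: dU s1 :: nil)%list
      (dEl s2 (dApp (dVar 2) (dVar 0))).

(* Pattern variables of the second rule: A, B, A', B', M, N are 0, ..., 5. *)
Inductive epts_rule (P : pts_spec)
  : dkterm (sort P) -> dkterm (sort P) -> Prop :=
| rule_El s1 s2 :
    axm P s1 s2 -> epts_rule P (dEl s2 (du s1)) (dU s1)
| rule_app s1 s2 s3 :
    rul P s1 s2 s3 ->
    epts_rule P
      (dapp s1 s2 (dVar 0) (dVar 1)
         (dabs s1 s2 (dVar 2) (dVar 3) (dVar 4)) (dVar 5))
      (dApp (dVar 4) (dVar 5)).

Definition epts_theory (P : pts_spec) : dtheory (@epts_ar (sort P)) :=
  DTheory (epts_sig P) (epts_rule P).

Fixpoint tr {S : Type} (M : eterm S) : dkterm S :=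
  match M with
  | eVar n => dVar n
  | eSort s => du s
  | ePi s1 s2 A B =>
      dProd s1 s2 (tr A) (dLam (dEl s1 (tr A)) (tr B))
  | eLam s1 s2 A B M =>
      dabs s1 s2 (tr A) (dLam (dEl s1 (tr A)) (tr B))
        (dLam (dEl s1 (tr A)) (tr M))
  | eApp s1 s2 A B M N =>
      dapp s1 s2 (tr A) (dLam (dEl s1 (tr A)) (tr B)) (tr M) (tr N)
  end.

(* [tr_ctx P G D] means that D is the translation of G.  It is a relation since
   the sort s_A used at each step is only given by G |- A : s_A. *)
Inductive tr_ctx (P : pts_spec) : ectx P -> list (dkterm (sort P)) -> Prop :=
| tr_nil : tr_ctx P nil nil
| tr_cons G D A s :
    tr_ctx P G D -> ety P G A (eSort s) ->
    tr_ctx P (cons A G) (cons (dEl s (tr A)) D).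

(* Main.v *)
From Stdlib Require Import List Relations Lia Classical.
From Stdlib Require Vector Fin.
Require Import Defs.
Import Vector.VectorNotations.

(* EPTS reduction is confluent on raw terms, whence uniqueness of types, subject
   reduction, and the fact that convertible types live in the same sort. The
   translation commutes with substitution and maps convertible terms to
   convertible terms. Typing is then preserved by induction on derivations. The
   delicate case is conversion between A and B : s, where A may be a sort: then
   B reduces to A, so A : s and A is not a top-sort. The types B x
   in abs and B N in app are beta-expansions of the translated types: typing the
   former needs weakening in Dedukti, and typing the reduct of the latter needs
   substitution. *)

(** Raw confluence rests on the left-linearity of the EPTS rule: the four type annotations of a
    redex are independent variables. That they agree up to conversion is recovered by typing,
    through injectivity of products, when the redex is contracted in subject reduction. Conversion
    is untyped, so a chain between two well-typed types may pass through ill-typed terms. Their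
    sorts are compared at a common reduct, which subject reduction types from both ends. On the
    Dedukti side, stability of typing under substitution yields both weakening and instantiation; in
    the case of a constant it relies on each declaration being closed over its own parameters. The
    invariant of the final induction keeps the [U] form and the [El] form of a typing together:
    premises of the shape [A : s] are consumed as [U], whereas conversion and variables produce
    [El]. *)

Lemma clos_rt_map {X Y : Type} (R : X -> X -> Prop) (Q : Y -> Y -> Prop)
    (F : X -> Y) :
  (forall x y, R x y -> Q (F x) (F y)) ->
  forall x y, clos_refl_trans _ R x y -> clos_refl_trans _ Q (F x) (F y).
Proof.
  intros HF x y H; induction H.
  - now apply rt_step, HF.
  - apply rt_refl.
  - eapply rt_trans; eassumption.
Qed.

Lemma clos_rst_map {X Y : Type} (R : X -> X -> Prop) (Q : Y -> Y -> Prop)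
    (F : X -> Y) :
  (forall x y, R x y -> clos_refl_sym_trans _ Q (F x) (F y)) ->
  forall x y, clos_refl_sym_trans _ R x y ->
    clos_refl_sym_trans _ Q (F x) (F y).
Proof.
  intros HF x y H; induction H.
  - now apply HF.
  - apply rst_refl.
  - now apply rst_sym.
  - eapply rst_trans; eassumption.
Qed.

(** * Substitution in EPTS terms *)

(** The composite is a separate function known only pointwise, so that the hypothesis lifts under
    binders without function extensionality. In this form renamings and substitutions are composed
    in four lemmas, where lifting for substitutions draws on the mixed cases. *)
Lemma eren_comp {T : Type} (M : eterm T) :
  forall q r p, (forall n, r (q n) = p n) -> eren r (eren q M) = eren p M.
Proof.
  assert (U : forall q r p : nat -> nat, (forall n, r (q n) = p n) ->
    forall n, upren r (upren q n) = upren p n).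
  { intros q r p H [|n]; simpl; congruence. }
  induction M; intros q r p H; simpl; auto; f_equal; auto.
Qed.

Lemma esubst_eren_comp {T : Type} (M : eterm T) :
  forall r f g, (forall n, f (r n) = g n) -> esubst f (eren r M) = esubst g M.
Proof.
  assert (U : forall r (f g : nat -> eterm T), (forall n, f (r n) = g n) ->
    forall n, eup f (upren r n) = eup g n).
  { intros r f g H [|n]; simpl; congruence. }
  induction M; intros r f g H; simpl; auto; f_equal; auto.
Qed.

Lemma eren_esubst_comp {T : Type} (M : eterm T) :
  forall r f g, (forall n, eren r (f n) = g n) ->
    eren r (esubst f M) = esubst g M.
Proof.
  assert (U : forall r (f g : nat -> eterm T), (forall n, eren r (f n) = g n) ->
    forall n, eren (upren r) (eup f n) = eup g n).
  { intros r f g H [|n]; simpl; auto. rewrite <- H.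
    rewrite (eren_comp _ _ _ (fun m => S (r m))) by reflexivity.
    now rewrite (eren_comp _ _ _ (fun m => S (r m))). }
  induction M; intros r f g H; simpl; auto; f_equal; auto.
Qed.

Lemma esubst_comp {T : Type} (M : eterm T) :
  forall f g h, (forall n, esubst g (f n) = h n) ->
    esubst g (esubst f M) = esubst h M.
Proof.
  assert (U : forall f g h : nat -> eterm T,
    (forall n, esubst g (f n) = h n) ->
    forall n, esubst (eup g) (eup f n) = eup h n).
  { intros f g h H [|n]; simpl; auto. rewrite <- H.
    rewrite (esubst_eren_comp _ _ _ (fun m => eren S (g m))) by reflexivity.
    now rewrite (eren_esubst_comp _ _ _ (fun m => eren S (g m))). }
  induction M; intros f g h H; simpl; auto; f_equal; auto.
Qed.

Lemma esubst_id {T : Type} (M : eterm T) :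
  forall f, (forall n, f n = eVar n) -> esubst f M = M.
Proof.
  assert (U : forall f : nat -> eterm T, (forall n, f n = eVar n) ->
    forall n, eup f n = eVar n).
  { intros f H [|n]; simpl; rewrite ?H; auto. }
  induction M; intros f H; simpl; auto; f_equal; auto.
Qed.

Lemma esubst_ext {T : Type} (M : eterm T) :
  forall f g, (forall n, f n = g n) -> esubst f M = esubst g M.
Proof.
  assert (U : forall f g : nat -> eterm T, (forall n, f n = g n) ->
    forall n, eup f n = eup g n).
  { intros f g H [|n]; simpl; congruence. }
  induction M; intros f g H; simpl; auto; f_equal; auto.
Qed.

Lemma eren_esubst_var {T : Type} (r : nat -> nat) (M : eterm T) :
  eren r M = esubst (fun n => eVar (r n)) M.
Proof.
  rewrite <- (esubst_id (eren r M) eVar) by reflexivity.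
  now apply esubst_eren_comp.
Qed.

Lemma esubst_esubst1 {T : Type} (f : nat -> eterm T) (N M : eterm T) :
  esubst f (esubst1 N M) = esubst1 (esubst f N) (esubst (eup f) M).
Proof.
  unfold esubst1. etransitivity.
  - apply esubst_comp. intros n; reflexivity.
  - symmetry. apply esubst_comp. intros [|n]; simpl; auto.
    rewrite (esubst_eren_comp _ _ _ eVar) by reflexivity.
    now apply esubst_id.
Qed.

Lemma esubst1_eren {T : Type} (N M : eterm T) : esubst1 N (eren S M) = M.
Proof.
  unfold esubst1. rewrite (esubst_eren_comp _ _ _ eVar) by reflexivity.
  now apply esubst_id.
Qed.

(** * Confluence of EPTS reduction *)

(** Parallel reduction in the style of Tait and Martin-Löf. Contraction discards the annotations,
    hence [epar_beta] only reduces the body and the argument. *)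
Inductive epar (P : pts_spec) : eterm (sort P) -> eterm (sort P) -> Prop :=
| epar_var n : epar P (eVar n) (eVar n)
| epar_sort s : epar P (eSort s) (eSort s)
| epar_pi s1 s2 A A' B B' :
    epar P A A' -> epar P B B' -> epar P (ePi s1 s2 A B) (ePi s1 s2 A' B')
| epar_lam s1 s2 A A' B B' M M' :
    epar P A A' -> epar P B B' -> epar P M M' ->
    epar P (eLam s1 s2 A B M) (eLam s1 s2 A' B' M')
| epar_app s1 s2 A A' B B' M M' N N' :
    epar P A A' -> epar P B B' -> epar P M M' -> epar P N N' ->
    epar P (eApp s1 s2 A B M N) (eApp s1 s2 A' B' M' N')
| epar_beta s1 s2 s3 A B A' B' M M' N N' :
    rul P s1 s2 s3 -> epar P M M' -> epar P N N' ->
    epar P (eApp s1 s2 A B (eLam s1 s2 A' B' M) N) (esubst1 N' M').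

Lemma epar_refl (P : pts_spec) M : epar P M M.
Proof. induction M; constructor; assumption. Qed.

Lemma epar_eren (P : pts_spec) M M' :
  epar P M M' -> forall r, epar P (eren r M) (eren r M').
Proof.
  induction 1; intros r; simpl; try (constructor; auto; fail).
  (* The renaming is read as a substitution to commute it with [esubst1], then folded back into a
     renaming. *)
  rewrite (eren_esubst_var r (esubst1 _ _)), esubst_esubst1, <- eren_esubst_var.
  rewrite (esubst_ext M' _ (fun n => eVar (upren r n)))
    by (intros [|n]; reflexivity).
  rewrite <- eren_esubst_var. econstructor; eauto.
Qed.

Lemma epar_esubst (P : pts_spec) M M' :
  epar P M M' -> forall f g, (forall n, epar P (f n) (g n)) ->
    epar P (esubst f M) (esubst g M').
Proof.
  assert (U : forall f g, (forall n, epar P (f n) (g n)) ->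
    forall n, epar P (eup f n) (eup g n)).
  { intros f g H [|n]; simpl; [constructor | now apply epar_eren]. }
  induction 1; intros f g Hfg; simpl; try (constructor; auto; fail).
  - apply Hfg.
  - rewrite esubst_esubst1. econstructor; eauto.
Qed.

Lemma epar_esubst1 (P : pts_spec) M M' N N' :
  epar P M M' -> epar P N N' -> epar P (esubst1 N M) (esubst1 N' M').
Proof.
  intros HM HN. apply epar_esubst; auto.
  intros [|n]; auto. constructor.
Qed.

Lemma epar_lam_inv (P : pts_spec) s1 s2 A B M L :
  epar P (eLam s1 s2 A B M) L ->
  exists A' B' M', L = eLam s1 s2 A' B' M' /\ epar P M M'.
Proof. inversion 1; subst; eauto. Qed.

Lemma epar_diamond (P : pts_spec) M M1 :
  epar P M M1 -> forall M2, epar P M M2 ->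
  exists L, epar P M1 L /\ epar P M2 L.
Proof.
  induction 1 as [n | s | s1 s2 A A' B B' HA IHA HB IHB
    | s1 s2 A A' B B' M M' HA IHA HB IHB HM IHM
    | s1 s2 A A' B B' M M' N N' HA IHA HB IHB HM IHM HN IHN
    | s1 s2 s3 A B A' B' M M' N N' Hr HM IHM HN IHN];
    intros M2 H2.
  - exists M2; split; auto using epar_refl.
  - exists M2; split; auto using epar_refl.
  - inversion H2; subst.
    edestruct IHA as [A3 []]; eauto. edestruct IHB as [B3 []]; eauto.
    exists (ePi s1 s2 A3 B3); split; constructor; auto.
  - inversion H2; subst.
    edestruct IHA as [A3 []]; eauto. edestruct IHB as [B3 []]; eauto.
    edestruct IHM as [M3 []]; eauto.
    exists (eLam s1 s2 A3 B3 M3); split; constructor; auto.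
  - inversion H2; subst.
    + edestruct IHA as [A3 []]; eauto. edestruct IHB as [B3 []]; eauto.
      edestruct IHM as [M3 []]; eauto. edestruct IHN as [N3 []]; eauto.
      exists (eApp s1 s2 A3 B3 M3 N3); split; constructor; auto.
    (* Critical pair: one side keeps the application, the other contracts it. The hypothesis on the
       abstraction is applied to the reduct in which only the body has moved; the joining term is
       again an abstraction, and its body closes the diagram. *)
    + edestruct IHM as [M3 [H3 H4]].
      { apply epar_lam; [apply epar_refl | apply epar_refl | eassumption]. }
      edestruct IHN as [N3 []]; eauto.
      apply epar_lam_inv in HM as [A4 [B4 [M4 [-> HM]]]].
      apply epar_lam_inv in H3 as [A5 [B5 [M5 [-> H3]]]].
      apply epar_lam_inv in H4 as [A6 [B6 [M6 [E H4]]]].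
      injection E as <- <- <-.
      exists (esubst1 N3 M5); split.
      * eapply epar_beta; eauto.
      * apply epar_esubst1; auto.
  - inversion H2; subst.
    + match goal with H : epar P (eLam _ _ _ _ _) _ |- _ =>
        apply epar_lam_inv in H as [A4 [B4 [M4 [-> ?]]]] end.
      edestruct IHM as [M3 []]; eauto. edestruct IHN as [N3 []]; eauto.
      exists (esubst1 N3 M3); split.
      * apply epar_esubst1; auto.
      * eapply epar_beta; eauto.
    + edestruct IHM as [M3 []]; eauto. edestruct IHN as [N3 []]; eauto.
      exists (esubst1 N3 M3); split; apply epar_esubst1; auto.
Qed.

Lemma diamond_confluent {X : Type} (R : X -> X -> Prop) :
  (forall x y, R x y -> forall z, R x z -> exists w, R y w /\ R z w) ->
  forall x y, clos_refl_trans _ R x y -> forall z, clos_refl_trans _ R x z ->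
    exists w, clos_refl_trans _ R y w /\ clos_refl_trans _ R z w.
Proof.
  intros HD.
  (* Strip lemma: many steps against a single one. *)
  assert (strip : forall x y, clos_refl_trans _ R x y -> forall z, R x z ->
    exists w, R y w /\ clos_refl_trans _ R z w).
  { intros x y H; induction H as [x y H | x | x y t _ IH1 _ IH2]; intros z Hz.
    - destruct (HD _ _ H _ Hz) as [w []]; exists w; auto using rt_step.
    - exists z; auto using rt_refl.
    - destruct (IH1 _ Hz) as [w [Hw ?]], (IH2 _ Hw) as [v []].
      exists v; split; auto. eapply rt_trans; eassumption. }
  intros x y Hy z Hz; revert y Hy.
  induction Hz as [x z H | x | x z t _ IH1 _ IH2]; intros y Hy.
  - destruct (strip _ _ Hy _ H) as [w []]; exists w; auto using rt_step.
  - exists y; auto using rt_refl.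
  - destruct (IH1 _ Hy) as [w [? Hw]], (IH2 _ Hw) as [v []].
    exists v; split; auto. eapply rt_trans; eassumption.
Qed.

Lemma ered_epar (P : pts_spec) M M' : ered P M M' -> epar P M M'.
Proof.
  induction 1; try (constructor; auto using epar_refl; fail).
  econstructor; eauto using epar_refl.
Qed.

(** With [ered_epar], parallel reduction lies between one step and many, so confluence transfers to
    [ered]. *)
Lemma epar_ereds (P : pts_spec) M M' :
  epar P M M' -> clos_refl_trans _ (ered P) M M'.
Proof.
  induction 1.
  - apply rt_refl.
  - apply rt_refl.
  - apply rt_trans with (ePi s1 s2 A' B).
    + apply (clos_rt_map _ (ered P) (fun X => ePi s1 s2 X B)) in IHepar1; auto.
      intros; now constructor.
    + apply (clos_rt_map _ (ered P) (fun X => ePi s1 s2 A' X)) in IHepar2; auto.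
      intros; now constructor.
  - apply rt_trans with (eLam s1 s2 A' B M).
    { apply (clos_rt_map _ (ered P) (fun X => eLam s1 s2 X B M)) in IHepar1; auto.
      intros; now constructor. }
    apply rt_trans with (eLam s1 s2 A' B' M).
    + apply (clos_rt_map _ (ered P) (fun X => eLam s1 s2 A' X M)) in IHepar2; auto.
      intros; now constructor.
    + apply (clos_rt_map _ (ered P) (fun X => eLam s1 s2 A' B' X)) in IHepar3; auto.
      intros; now constructor.
  - apply rt_trans with (eApp s1 s2 A' B M N).
    { apply (clos_rt_map _ (ered P) (fun X => eApp s1 s2 X B M N)) in IHepar1; auto.
      intros; now constructor. }
    apply rt_trans with (eApp s1 s2 A' B' M N).
    { apply (clos_rt_map _ (ered P) (fun X => eApp s1 s2 A' X M N)) in IHepar2; auto.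
      intros; now constructor. }
    apply rt_trans with (eApp s1 s2 A' B' M' N).
    + apply (clos_rt_map _ (ered P) (fun X => eApp s1 s2 A' B' X N)) in IHepar3; auto.
      intros; now constructor.
    + apply (clos_rt_map _ (ered P) (fun X => eApp s1 s2 A' B' M' X)) in IHepar4; auto.
      intros; now constructor.
  - apply rt_trans with (eApp s1 s2 A B (eLam s1 s2 A' B' M') N).
    { apply (clos_rt_map _ (ered P) (fun X => eApp s1 s2 A B (eLam s1 s2 A' B' X) N))
        in IHepar1; auto.
      intros; now do 2 constructor. }
    apply rt_trans with (eApp s1 s2 A B (eLam s1 s2 A' B' M') N').
    + apply (clos_rt_map _ (ered P) (fun X => eApp s1 s2 A B (eLam s1 s2 A' B' M') X))
        in IHepar2; auto.
      intros; now constructor.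
    + apply rt_step. econstructor; eauto.
Qed.

Lemma epars_ereds (P : pts_spec) M M' :
  clos_refl_trans _ (epar P) M M' -> clos_refl_trans _ (ered P) M M'.
Proof.
  induction 1; [now apply epar_ereds | apply rt_refl |].
  eapply rt_trans; eassumption.
Qed.

Lemma epar_econv (P : pts_spec) M M' : epar P M M' -> econv P M M'.
Proof. intros H. now apply clos_rt_clos_rst, epar_ereds. Qed.

Lemma epars_econv (P : pts_spec) M M' :
  clos_refl_trans _ (epar P) M M' -> econv P M M'.
Proof. intros H. now apply clos_rt_clos_rst, epars_ereds. Qed.

Lemma econv_church_rosser (P : pts_spec) M N :
  econv P M N -> exists L, clos_refl_trans _ (epar P) M L /\
                           clos_refl_trans _ (epar P) N L.
Proof.
  induction 1 as [M N H | M | M N _ [L []] | M N O _ [L [H1 H2]] _ [K [H3 H4]]].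
  - exists N; split; [now apply rt_step, ered_epar | apply rt_refl].
  - exists M; split; apply rt_refl.
  - now exists L.
  - destruct (diamond_confluent _ (epar_diamond P) _ _ H2 _ H3) as [J []].
    exists J; split; eapply rt_trans; eassumption.
Qed.

Lemma epars_sort_inv (P : pts_spec) s M :
  clos_refl_trans _ (epar P) (eSort s) M -> M = eSort s.
Proof.
  intros H; apply clos_rt_rtn1_iff in H.
  induction H as [|M M' H _ IH]; auto. subst; now inversion H.
Qed.

Lemma epars_pi_inv (P : pts_spec) s1 s2 A B M :
  clos_refl_trans _ (epar P) (ePi s1 s2 A B) M ->
  exists A' B', M = ePi s1 s2 A' B' /\ clos_refl_trans _ (epar P) A A' /\
                clos_refl_trans _ (epar P) B B'.
Proof.
  intros H; apply clos_rt_rtn1_iff in H.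
  induction H as [|M M' H _ [A' [B' [-> [HA HB]]]]].
  - exists A, B; auto using rt_refl.
  - inversion H; subst. do 2 eexists; split; [reflexivity|].
    split; eapply rt_trans; eauto using rt_step.
Qed.

Lemma econv_sort_epars (P : pts_spec) s M :
  econv P M (eSort s) -> clos_refl_trans _ (epar P) M (eSort s).
Proof.
  intros H. destruct (econv_church_rosser _ _ _ H) as [L [H1 H2]].
  apply epars_sort_inv in H2; now subst.
Qed.

Lemma econv_sort_inj (P : pts_spec) s s' :
  econv P (eSort s) (eSort s') -> s = s'.
Proof.
  intros H. apply econv_sort_epars, epars_sort_inv in H. congruence.
Qed.

Lemma econv_pi_inj (P : pts_spec) s1 s2 A B s1' s2' A' B' :
  econv P (ePi s1 s2 A B) (ePi s1' s2' A' B') ->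
  econv P A A' /\ econv P B B'.
Proof.
  intros H. destruct (econv_church_rosser _ _ _ H) as [L [H1 H2]].
  apply epars_pi_inv in H1 as [A1 [B1 [-> [HA1 HB1]]]].
  apply epars_pi_inv in H2 as [A2 [B2 [E [HA2 HB2]]]].
  injection E as <- <- <- <-.
  split; (eapply rst_trans; [|apply rst_sym]); apply epars_econv; eassumption.
Qed.

Lemma econv_esubst (P : pts_spec) f M M' :
  econv P M M' -> econv P (esubst f M) (esubst f M').
Proof.
  apply clos_rst_map. intros x y H. apply epar_econv.
  apply epar_esubst; auto using ered_epar, epar_refl.
Qed.

(** * Metatheory of EPTS typing *)

Lemma eren_ext {T : Type} (M : eterm T) r q :
  (forall n, r n = q n) -> eren r M = eren q M.
Proof.
  intros H. rewrite !eren_esubst_var. apply esubst_ext. intros n; now rewrite H.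
Qed.

Lemma eren_shift_S {T : Type} (n : nat) (M : eterm T) :
  eren (fun m => m + S (S n)) M = eren S (eren (fun m => m + S n) M).
Proof. symmetry; apply eren_comp. intros; lia. Qed.

Lemma eren_shift_1 {T : Type} (M : eterm T) :
  eren (fun m => m + 1) M = eren S M.
Proof. apply eren_ext. intros; lia. Qed.

Lemma esubst_eup_eren {T : Type} (f : nat -> eterm T) (M : eterm T) :
  esubst (eup f) (eren S M) = eren S (esubst f M).
Proof.
  rewrite (eren_esubst_comp _ _ _ (fun n => eren S (f n))) by reflexivity.
  now apply esubst_eren_comp.
Qed.

Lemma ety_ewf (P : pts_spec) G M A : ety P G M A -> ewf P G.
Proof. induction 1; auto. Qed.

(* Stated for a class [K] of substitutions closed under lifting, so that
   renaming and substitution are both instances: lifting a well-typed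
   substitution itself requires weakening. *)
Lemma ety_esubst_class (P : pts_spec)
    (K : ectx P -> (nat -> eterm (sort P)) -> ectx P -> Prop) :
  (forall G f G' n A, K G f G' -> ewf P G' -> nth_error G n = Some A ->
     ety P G' (f n) (esubst f (eren (fun m => m + S n) A))) ->
  (forall G f G' A, K G f G' -> ewf P (cons (esubst f A) G') ->
     K (cons A G) (eup f) (cons (esubst f A) G')) ->
  forall G M A, ety P G M A -> forall f G', K G f G' -> ewf P G' ->
    ety P G' (esubst f M) (esubst f A).
Proof.
  intros Hvar Hlift G M A H.
  induction H as [G M A B s _ IHM _ IHB HAB | G s1 s2 HG Hs | G n A HG Hn
    | G s1 s2 s3 A B Hr _ IHA _ IHB
    | G s1 s2 s3 A B M Hr _ IHA _ IHB _ IHM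
    | G s1 s2 s3 A B M N Hr _ IHA _ IHB _ IHN _ IHM];
    intros f G' Hf HG'; simpl.
  - eapply ety_conv; [apply IHM | apply (IHB f) | apply econv_esubst]; auto.
  - now constructor.
  - now apply Hvar with G.
  (* Entering the binder requires the extended target context to be well-formed; the hypothesis for
     [A] supplies this. *)
  - assert (ewf P (cons (esubst f A) G')) by (econstructor; apply (IHA f); auto).
    eapply ety_pi; [eassumption | apply (IHA f) | apply (IHB (eup f))]; auto.
  - assert (ewf P (cons (esubst f A) G')) by (econstructor; apply (IHA f); auto).
    eapply ety_lam;
      [eassumption | apply (IHA f) | apply (IHB (eup f)) | apply IHM]; auto.
  - assert (ewf P (cons (esubst f A) G')) by (econstructor; apply (IHA f); auto).
    rewrite esubst_esubst1. eapply ety_app;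
      [eassumption | apply (IHA f) | apply (IHB (eup f)) | apply IHN | apply IHM];
      auto.
Qed.

Lemma ety_weaken (P : pts_spec) G M A C :
  ety P G M A -> ewf P (cons C G) -> ety P (cons C G) (eren S M) (eren S A).
Proof.
  intros H HC. rewrite !eren_esubst_var.
  (* The class of renamings: each variable goes to a variable of the corresponding type, a property
     that lifts without appeal to weakening. *)
  apply (ety_esubst_class P (fun G f G' => forall n A, nth_error G n = Some A ->
    exists k B, f n = eVar k /\ nth_error G' k = Some B /\
      eren (fun m => m + S k) B = esubst f (eren (fun m => m + S n) A)))
    with G; auto; clear.
  - intros G f G' n A Hf HG' Hn. destruct (Hf _ _ Hn) as [k [B [-> [Hk <-]]]].
    now constructor.
  - intros G f G' A Hf _ [|n] B Hn; simpl in Hn.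
    + injection Hn as <-. exists 0, (esubst f A); split; [|split]; auto.
      now rewrite !eren_shift_1, esubst_eup_eren.
    + destruct (Hf _ _ Hn) as [k [B' [E [Hk HB]]]]. exists (S k), B'.
      split; [simpl; now rewrite E | split; auto].
      now rewrite !eren_shift_S, HB, esubst_eup_eren.
  - intros n A Hn. exists (S n), A; split; [|split]; auto.
    now rewrite eren_shift_S, <- eren_esubst_var.
Qed.

Definition esub_ok (P : pts_spec) (G : ectx P) (f : nat -> eterm (sort P))
  (G' : ectx P) : Prop :=
  forall n A, nth_error G n = Some A ->
    ety P G' (f n) (esubst f (eren (fun m => m + S n) A)).

Lemma ety_esubst (P : pts_spec) G M A f G' :
  ety P G M A -> esub_ok P G f G' -> ewf P G' ->
  ety P G' (esubst f M) (esubst f A).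
Proof.
  intros H Hf HG'. apply (ety_esubst_class P (esub_ok P)) with G; auto; clear.
  intros G f G' A Hf HA [|n] B Hn; simpl in Hn.
  - injection Hn as <-. rewrite eren_shift_1, esubst_eup_eren, <- eren_shift_1.
    now constructor.
  - rewrite eren_shift_S, esubst_eup_eren. apply ety_weaken; auto.
Qed.

Lemma ety_esubst1 (P : pts_spec) G A N M B :
  ety P (cons A G) M B -> ety P G N A ->
  ety P G (esubst1 N M) (esubst1 N B).
Proof.
  intros HM HN. assert (HG := ety_ewf _ _ _ _ HN).
  apply ety_esubst with (cons A G); auto.
  intros [|n] C Hn; simpl in Hn.
  - injection Hn as <-. rewrite eren_shift_1. fold (esubst1 N (eren S A)).
    now rewrite esubst1_eren.
  - rewrite eren_shift_S.
    fold (esubst1 N (eren S (eren (fun m => m + S n) C))).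
    rewrite esubst1_eren. now constructor.
Qed.

Lemma econv_eren (P : pts_spec) r M M' :
  econv P M M' -> econv P (eren r M) (eren r M').
Proof. rewrite !eren_esubst_var. apply econv_esubst. Qed.

(** The identity is a well-typed substitution between the two contexts: variable 0, declared with
    [A'], receives type [A] by conversion. *)
Lemma ety_ctx_conv (P : pts_spec) G A A' s s' M B :
  ety P (cons A G) M B -> ety P G A (eSort s) -> ety P G A' (eSort s') ->
  econv P A A' -> ety P (cons A' G) M B.
Proof.
  intros HM HA HA' HAA'.
  assert (HG : ewf P (cons A' G)) by (econstructor; eassumption).
  rewrite <- (esubst_id M eVar), <- (esubst_id B eVar) by reflexivity.
  apply ety_esubst with (cons A G); auto.
  intros n C Hn. rewrite esubst_id by reflexivity.
  destruct n as [|n]; simpl in Hn.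
  - injection Hn as <-. rewrite eren_shift_1.
    apply ety_conv with (eren S A') s.
    + rewrite <- eren_shift_1. now constructor.
    + exact (ety_weaken _ _ _ _ _ HA HG).
    + now apply econv_eren, rst_sym.
  - now constructor.
Qed.

Lemma ewf_nth (P : pts_spec) G n A :
  ewf P G -> nth_error G n = Some A ->
  exists s, ety P G (eren (fun m => m + S n) A) (eSort s).
Proof.
  intros HG; revert n A. induction G as [|C G IH]; intros [|n] A Hn;
    try discriminate; simpl in Hn; inversion HG as [|? ? s HC]; subst.
  - injection Hn as <-. exists s. rewrite eren_shift_1.
    exact (ety_weaken _ _ _ _ _ HC HG).
  - destruct (IH (ety_ewf _ _ _ _ HC) _ _ Hn) as [s' Hs']. exists s'.
    rewrite eren_shift_S. exact (ety_weaken _ _ _ _ _ Hs' HG).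
Qed.

(** The first alternative accounts for top-sorts, which have no type. Looking at the last rule
    suffices, because conversion carries the sort of its target. *)
Lemma ety_type_correct (P : pts_spec) G M A :
  ety P G M A ->
  (exists s, A = eSort s) \/ (exists s, ety P G A (eSort s)).
Proof.
  destruct 1; eauto.
  - right; now apply ewf_nth.
  - right; exists s3; eapply ety_pi; eauto.
  - right; exists s2. now apply (ety_esubst1 _ _ _ _ _ _ H1).
Qed.

(** Generation: the syntax-directed rule below any number of conversions. Typings of subterms are
    recorded for abstractions alone, where the contraction of a redex opens them. *)
Lemma ety_inv (P : pts_spec) G M T :
  ety P G M T ->
  match M with
  | eVar n => exists A, nth_error G n = Some A /\
                econv P (eren (fun m => m + S n) A) T
  | eSort s => exists s', axm P s s' /\ econv P (eSort s') T
  | ePi s1 s2 A B =>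
      exists s3, rul P s1 s2 s3 /\ econv P (eSort s3) T
  | eLam s1 s2 A B M =>
      exists s3, rul P s1 s2 s3 /\ ety P G A (eSort s1) /\
        ety P (cons A G) B (eSort s2) /\ ety P (cons A G) M B /\
        econv P (ePi s1 s2 A B) T
  | eApp s1 s2 A B M N => econv P (esubst1 N B) T
  end.
Proof.
  induction 1 as [G M A B s _ IHM _ _ HAB | | | | |]; simpl.
  - destruct M; repeat match goal with
      | H : exists _, _ |- _ => destruct H
      | H : _ /\ _ |- _ => destruct H
      end; repeat (esplit; try eassumption); eapply rst_trans; eassumption.
  - exists s2; split; auto. apply rst_refl.
  - exists A; split; auto. apply rst_refl.
  - exists s3; split; auto. apply rst_refl.
  - exists s3; repeat split; auto. apply rst_refl.
  - apply rst_refl.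
Qed.

(** The annotations determine the type up to conversion, so inverting both derivations is enough,
    without induction. Functionality identifies the sorts found for a sort and for a product. *)
Lemma ety_unique (P : pts_spec) (HP : functional_pts P) G M A B :
  ety P G M A -> ety P G M B -> econv P A B.
Proof.
  intros HA HB. apply ety_inv in HA, HB. destruct HP as [HP1 HP2].
  destruct M.
  - destruct HA as [C [HC HA]], HB as [C' [HC' HB]].
    assert (C' = C) as -> by congruence.
    eapply rst_trans; [apply rst_sym|]; eassumption.
  - destruct HA as [t [Ht HA]], HB as [t' [Ht' HB]].
    rewrite (HP1 _ _ _ Ht' Ht) in HB.
    eapply rst_trans; [apply rst_sym|]; eassumption.
  - destruct HA as [t [Ht HA]], HB as [t' [Ht' HB]].
    rewrite (HP2 _ _ _ _ Ht' Ht) in HB.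
    eapply rst_trans; [apply rst_sym|]; eassumption.
  - destruct HA as [? [_ [_ [_ [_ HA]]]]], HB as [? [_ [_ [_ [_ HB]]]]].
    eapply rst_trans; [apply rst_sym|]; eassumption.
  - eapply rst_trans; [apply rst_sym|]; eassumption.
Qed.

Lemma ety_unique_sort (P : pts_spec) (HP : functional_pts P) G M s s' :
  ety P G M (eSort s) -> ety P G M (eSort s') -> s = s'.
Proof.
  intros H H'. eapply econv_sort_inj, ety_unique; eassumption.
Qed.

Lemma ety_sort_axm (P : pts_spec) G s s' :
  ety P G (eSort s) (eSort s') -> axm P s s'.
Proof.
  intros H. apply ety_inv in H as [t [Ht H]].
  now apply econv_sort_inj in H as <-.
Qed.

(** When a step changes the type that the rule yields, the former type is restored by conversion;
    [HPi] and [HBN] provide the sort that conversion demands. *)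
Lemma subject_reduction (P : pts_spec) G M A :
  ety P G M A -> forall M', ered P M M' -> ety P G M' A.
Proof.
  induction 1 as [G M A B s HM IHM HB _ HAB | |
    | G s1 s2 s3 A B Hr HA IHA HB IHB
    | G s1 s2 s3 A B M Hr HA IHA HB IHB HM IHM
    | G s1 s2 s3 A B M N Hr HA IHA HB IHB HN IHN HM IHM];
    intros M' Hred.
  - eapply ety_conv; eauto.
  - inversion Hred.
  - inversion Hred.
  - inversion Hred; subst; eapply ety_pi; eauto.
    eapply ety_ctx_conv; eauto. now apply rst_step.
  - assert (HPi : ety P G (ePi s1 s2 A B) (eSort s3)) by (eapply ety_pi; eauto).
    inversion Hred as [| | | ? ? ? A' ? ? HAA' | ? ? ? ? B' ? HBB'
      | ? ? ? ? ? ? HMM' | | | |]; subst.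
    + assert (econv P A A') by now apply rst_step.
      apply ety_conv with (ePi s1 s2 A' B) s3; auto.
      * eapply ety_lam; eauto using ety_ctx_conv.
      * apply rst_sym, rst_step. now constructor.
    + apply ety_conv with (ePi s1 s2 A B') s3; auto.
      * eapply ety_lam; eauto. eapply ety_conv; eauto. now apply rst_step.
      * apply rst_sym, rst_step. now constructor.
    + eapply ety_lam; eauto.
  - assert (HPi : ety P G (ePi s1 s2 A B) (eSort s3)) by (eapply ety_pi; eauto).
    assert (HBN : ety P G (esubst1 N B) (eSort s2))
      by exact (ety_esubst1 _ _ _ _ _ _ HB HN).
    inversion Hred as [? ? t3 ? ? A' B' L ? Ht | | | | |
      | ? ? ? A' ? ? ? HAA' | ? ? ? ? B' ? ? HBB'
      | ? ? ? ? ? ? ? HMM' | ? ? ? ? ? ? N' HNN']; subst.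
    (* The redex: inversion types the body with the annotations [A'], [B'] of the abstraction, and
       injectivity of products relates them to [A], [B]. *)
    + apply ety_inv in HM as [? [_ [HA' [HB' [HL HC]]]]].
      apply econv_pi_inj in HC as [HAA' HBB'].
      assert (HN' : ety P G N A')
        by (eapply ety_conv; eauto; now apply rst_sym).
      apply ety_conv with (esubst1 N B') s2; auto.
      * now apply ety_esubst1 with A'.
      * now apply econv_esubst.
    (* The result type is unchanged here, but the function has to be retyped at the product with the
       reduced annotation. *)
    + assert (econv P A A') by now apply rst_step.
      apply ety_app with s3; eauto using ety_ctx_conv, ety_conv.
      apply ety_conv with (ePi s1 s2 A B) s3; auto.
      * eapply ety_pi; eauto using ety_ctx_conv.
      * apply rst_step. now constructor.
    + assert (econv P B B') by now apply rst_step.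
      apply ety_conv with (esubst1 N B') s2; auto.
      * apply ety_app with s3; auto.
        apply ety_conv with (ePi s1 s2 A B) s3; auto.
        -- eapply ety_pi; eauto.
        -- apply rst_step. now constructor.
      * now apply econv_esubst, rst_sym.
    + eapply ety_app; eauto.
    + apply ety_conv with (esubst1 N' B) s2; auto.
      * eapply ety_app; eauto.
      * apply rst_sym, epar_econv, epar_esubst1;
          [apply epar_refl | now apply ered_epar].
Qed.

Lemma subject_reduction_epars (P : pts_spec) G M M' A :
  clos_refl_trans _ (epar P) M M' -> ety P G M A -> ety P G M' A.
Proof.
  intros H. apply epars_ereds in H.
  induction H; eauto using subject_reduction.
Qed.

Lemma ety_econv_sort (P : pts_spec) (HP : functional_pts P) G A B s s' :
  econv P A B -> ety P G A (eSort s) -> ety P G B (eSort s') -> s = s'.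
Proof.
  intros H HA HB. destruct (econv_church_rosser _ _ _ H) as [L [HAL HBL]].
  apply (ety_unique_sort P HP G L).
  - exact (subject_reduction_epars _ _ _ _ _ HAL HA).
  - exact (subject_reduction_epars _ _ _ _ _ HBL HB).
Qed.

(** * Substitution in Dedukti terms *)

(** The automatically generated principle gives no hypothesis for the arguments of a constant, which
    are nested in a vector; an inner fixpoint supplies it. *)
Lemma dterm_In_ind {C : Type} {ar : C -> nat} (Q : dterm ar -> Prop) :
  (forall n, Q (dVar n)) ->
  (forall c (v : Vector.t (dterm ar) (ar c)),
     (forall a, Vector.In a v -> Q a) -> Q (dCst c v)) ->
  (forall s, Q (dSort s)) ->
  (forall M N, Q M -> Q N -> Q (dApp M N)) ->
  (forall A M, Q A -> Q M -> Q (dLam A M)) ->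
  (forall A B, Q A -> Q B -> Q (dPi A B)) ->
  forall M, Q M.
Proof.
  intros HVar HCst HSort HApp HLam HPi. fix IH 1.
  intros [n | c v | s | M N | A M | A B];
    [apply HVar | | apply HSort | apply HApp; apply IH | apply HLam; apply IH
    | apply HPi; apply IH].
  apply HCst, Vector.Forall_forall.
  exact ((fix F n (v : Vector.t (dterm ar) n) : Vector.Forall Q v :=
    match v with
    | Vector.nil _ => Vector.Forall_nil Q
    | Vector.cons _ x _ w => Vector.Forall_cons Q x w (IH x) (F _ w)
    end) _ v).
Qed.

Ltac dterm_induction M :=
  induction M as [n | c v IHv | s | M N IHM IHN | A M IHA IHM | A B IHA IHB]
    using dterm_In_ind.

Lemma dren_comp {C : Type} {ar : C -> nat} (M : dterm ar) :
  forall q r p, (forall n, r (q n) = p n) -> dren r (dren q M) = dren p M.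
Proof.
  assert (U : forall q r p : nat -> nat, (forall n, r (q n) = p n) ->
    forall n, upren r (upren q n) = upren p n).
  { intros q r p H [|n]; simpl; congruence. }
  dterm_induction M; intros q r p H; simpl; auto; f_equal; auto.
  rewrite Vector.map_map. apply Vector.map_ext_in; auto.
Qed.

Lemma dsubst_dren_comp {C : Type} {ar : C -> nat} (M : dterm ar) :
  forall r f g, (forall n, f (r n) = g n) -> dsubst f (dren r M) = dsubst g M.
Proof.
  assert (U : forall r (f g : nat -> dterm ar), (forall n, f (r n) = g n) ->
    forall n, dup f (upren r n) = dup g n).
  { intros r f g H [|n]; simpl; congruence. }
  dterm_induction M; intros r f g H; simpl; auto; f_equal; auto.
  rewrite Vector.map_map. apply Vector.map_ext_in; auto.
Qed.

Lemma dren_dsubst_comp {C : Type} {ar : C -> nat} (M : dterm ar) :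
  forall r f g, (forall n, dren r (f n) = g n) ->
    dren r (dsubst f M) = dsubst g M.
Proof.
  assert (U : forall r (f g : nat -> dterm ar), (forall n, dren r (f n) = g n) ->
    forall n, dren (upren r) (dup f n) = dup g n).
  { intros r f g H [|n]; simpl; auto. rewrite <- H.
    rewrite (dren_comp _ _ _ (fun m => S (r m))) by reflexivity.
    now rewrite (dren_comp _ _ _ (fun m => S (r m))). }
  dterm_induction M; intros r f g H; simpl; auto; f_equal; auto.
  rewrite Vector.map_map. apply Vector.map_ext_in; auto.
Qed.

Lemma dsubst_comp {C : Type} {ar : C -> nat} (M : dterm ar) :
  forall f g h, (forall n, dsubst g (f n) = h n) ->
    dsubst g (dsubst f M) = dsubst h M.
Proof.
  assert (U : forall f g h : nat -> dterm ar,
    (forall n, dsubst g (f n) = h n) ->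
    forall n, dsubst (dup g) (dup f n) = dup h n).
  { intros f g h H [|n]; simpl; auto. rewrite <- H.
    rewrite (dsubst_dren_comp _ _ _ (fun m => dren S (g m))) by reflexivity.
    now rewrite (dren_dsubst_comp _ _ _ (fun m => dren S (g m))). }
  dterm_induction M; intros f g h H; simpl; auto; f_equal; auto.
  rewrite Vector.map_map. apply Vector.map_ext_in; auto.
Qed.

Lemma dsubst_id {C : Type} {ar : C -> nat} (M : dterm ar) :
  forall f, (forall n, f n = dVar n) -> dsubst f M = M.
Proof.
  assert (U : forall f : nat -> dterm ar, (forall n, f n = dVar n) ->
    forall n, dup f n = dVar n).
  { intros f H [|n]; simpl; rewrite ?H; auto. }
  dterm_induction M; intros f H; simpl; auto; f_equal; auto.
  rewrite <- (Vector.map_id _ _ v) at 2. apply Vector.map_ext_in; auto.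
Qed.

Lemma dsubst_ext {C : Type} {ar : C -> nat} (M : dterm ar) :
  forall f g, (forall n, f n = g n) -> dsubst f M = dsubst g M.
Proof.
  intros f g H. rewrite <- (dsubst_id M dVar) at 1 by reflexivity.
  now apply dsubst_comp.
Qed.

Lemma dren_dsubst_var {C : Type} {ar : C -> nat} (r : nat -> nat)
    (M : dterm ar) :
  dren r M = dsubst (fun n => dVar (r n)) M.
Proof.
  rewrite <- (dsubst_id (dren r M) dVar) by reflexivity.
  now apply dsubst_dren_comp.
Qed.

Lemma dren_ext {C : Type} {ar : C -> nat} (M : dterm ar) r q :
  (forall n, r n = q n) -> dren r M = dren q M.
Proof.
  intros H. rewrite !dren_dsubst_var. apply dsubst_ext. intros n; now rewrite H.
Qed.

Lemma dsubst1_dsubst {C : Type} {ar : C -> nat} (N M : dterm ar) :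
  dsubst1 N M =
  dsubst (fun n => match n with 0 => N | S m => dVar m end) M.
Proof.
  apply dsubst_ext. intros [|n]; simpl; auto.
  destruct n; simpl; auto.
Qed.

Lemma dsubst_dsubst1 {C : Type} {ar : C -> nat} (f : nat -> dterm ar)
    (N M : dterm ar) :
  dsubst f (dsubst1 N M) = dsubst1 (dsubst f N) (dsubst (dup f) M).
Proof.
  rewrite !dsubst1_dsubst. etransitivity.
  - apply dsubst_comp. intros n; reflexivity.
  - symmetry. apply dsubst_comp. intros [|n]; simpl; auto.
    rewrite (dsubst_dren_comp _ _ _ dVar) by reflexivity.
    now apply dsubst_id.
Qed.

Lemma dsubst1_dren {C : Type} {ar : C -> nat} (N M : dterm ar) :
  dsubst1 N (dren S M) = M.
Proof.
  rewrite dsubst1_dsubst, (dsubst_dren_comp _ _ _ dVar) by reflexivity.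
  now apply dsubst_id.
Qed.

Lemma dsubst1_var_dren {C : Type} {ar : C -> nat} (M : dterm ar) :
  dsubst1 (dVar 0) (dren (upren S) M) = M.
Proof.
  rewrite dsubst1_dsubst, (dsubst_dren_comp _ _ _ dVar) by now intros [|n].
  now apply dsubst_id.
Qed.

Lemma dren_shift_S {C : Type} {ar : C -> nat} (n : nat) (M : dterm ar) :
  dren (fun m => m + S (S n)) M = dren S (dren (fun m => m + S n) M).
Proof. symmetry; apply dren_comp. intros; lia. Qed.

Lemma dren_shift_1 {C : Type} {ar : C -> nat} (M : dterm ar) :
  dren (fun m => m + 1) M = dren S M.
Proof. apply dren_ext. intros; lia. Qed.

Lemma dsubst_dup_dren {C : Type} {ar : C -> nat} (f : nat -> dterm ar)
    (M : dterm ar) :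
  dsubst (dup f) (dren S M) = dren S (dsubst f M).
Proof.
  rewrite (dren_dsubst_comp _ _ _ (fun n => dren S (f n))) by reflexivity.
  now apply dsubst_dren_comp.
Qed.

(* A semantic rendering of "every free variable of [M] is smaller than [k]". *)
Definition dbounded {C : Type} {ar : C -> nat} (k : nat) (M : dterm ar) : Prop :=
  forall f g, (forall n, n < k -> f n = g n) -> dsubst f M = dsubst g M.

(** The last parameter is at the head, so its type may mention exactly the parameters of the
    tail. *)
Fixpoint dtelescope {C : Type} {ar : C -> nat} (D : list (dterm ar)) : Prop :=
  match D with
  | nil => True
  | cons A D => dbounded (length D) A /\ dtelescope D
  end.

Definition closed_sig {C : Type} {ar : C -> nat} (T : dtheory ar) : Prop :=
  forall c D A, dsig T c D A -> dbounded (length D) A /\ dtelescope D.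

(** The two sides can differ only at variables past the end of [l], which boundedness excludes. *)
Lemma dsubst_dsubstl {C : Type} {ar : C -> nat} (f : nat -> dterm ar) l A :
  dbounded (length l) A -> dsubst f (dsubstl l A) = dsubstl (map (dsubst f) l) A.
Proof.
  intros HA. unfold dsubstl at 1. etransitivity.
  { apply dsubst_comp; intros n; reflexivity. }
  apply HA. intros n Hn. rewrite nth_error_map.
  destruct (nth_error l n) eqn:E; simpl; auto.
  apply nth_error_None in E. lia.
Qed.

Lemma vector_map_replace {X Y : Type} (f : X -> Y) n (v : Vector.t X n) i a :
  Vector.map f (Vector.replace v i a) = Vector.replace (Vector.map f v) i (f a).
Proof.
  induction v as [|x n v IH]; [inversion i|].
  (* Dependent case analysis on the index, with the motive given explicitly. *)
  refine (Fin.caseS' i (fun i =>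
    Vector.map f (Vector.replace (Vector.cons _ x _ v) i a) =
    Vector.replace (Vector.map f (Vector.cons _ x _ v)) i (f a)) _ _);
    simpl; auto.
  intros j; now rewrite IH.
Qed.

Lemma dred_dsubst {C : Type} {ar : C -> nat} (T : dtheory ar) M M' :
  dred T M M' -> forall f, dred T (dsubst f M) (dsubst f M').
Proof.
  induction 1; intros f'; simpl; try (constructor; auto; fail).
  - rewrite dsubst_dsubst1. constructor.
  - rewrite (dsubst_comp l _ _ (fun n => dsubst f' (f n))) by reflexivity.
    rewrite (dsubst_comp r _ _ (fun n => dsubst f' (f n))) by reflexivity.
    now constructor.
  - rewrite vector_map_replace. constructor.
    now rewrite (Vector.nth_map _ _ _ _ eq_refl).
Qed.

Lemma dconv_dsubst {C : Type} {ar : C -> nat} (T : dtheory ar) f M M' :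
  dconv T M M' -> dconv T (dsubst f M) (dsubst f M').
Proof.
  apply clos_rst_map. intros x y H. now apply rst_step, dred_dsubst.
Qed.

(** * Metatheory of Dedukti typing *)

Scheme dty_dinst_ind := Minimality for dty Sort Prop
  with dinst_dty_ind := Minimality for dinst Sort Prop.

Lemma dty_dwf {C : Type} {ar : C -> nat} (T : dtheory ar) G M A :
  dty T G M A -> dwf T G.
Proof.
  intros H.
  induction H using dty_dinst_ind with (P0 := fun G _ _ => dwf T G); auto.
Qed.

Lemma dinst_length {C : Type} {ar : C -> nat} (T : dtheory ar) G l D :
  dinst T G l D -> length l = length D.
Proof. induction 1; simpl; congruence. Qed.

(** The Dedukti counterpart of [ety_esubst_class]. For a constant, the declaration and its typing
    stay fixed and only the instance is substituted, which is where closedness of the signature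
    enters. *)
Lemma dty_dsubst_class {C : Type} {ar : C -> nat} (T : dtheory ar)
    (HT : closed_sig T)
    (K : list (dterm ar) -> (nat -> dterm ar) -> list (dterm ar) -> Prop) :
  (forall G f G' n A, K G f G' -> dwf T G' -> nth_error G n = Some A ->
     dty T G' (f n) (dsubst f (dren (fun m => m + S n) A))) ->
  (forall G f G' A, K G f G' -> dwf T (cons (dsubst f A) G') ->
     K (cons A G) (dup f) (cons (dsubst f A) G')) ->
  forall G M A, dty T G M A -> forall f G', K G f G' -> dwf T G' ->
    dty T G' (dsubst f M) (dsubst f A).
Proof.
  intros Hvar Hlift G M A H.
  induction H as [G M A B s _ IHM _ IHB HAB | G HG | G n A HG Hn
    | G c v D A s Hc HA _ Hv IHv
    | G A B s _ IHA _ IHB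
    | G A B M s _ IHA _ IHB _ IHM
    | G A B M N _ IHM _ IHN
    | G HG
    | G l D N A Hl IHl _ IHN]
    using dty_dinst_ind with
    (P0 := fun G l D => dtelescope D -> forall f G', K G f G' -> dwf T G' ->
             dinst T G' (map (dsubst f) l) D).
  - intros f G' Hf HG'. eapply dty_conv; [apply IHM | apply (IHB f) |
      apply dconv_dsubst]; eauto.
  - intros f G' Hf HG'. now constructor.
  - intros f G' Hf HG'. now apply Hvar with G.
  - intros f G' Hf HG'. destruct (HT _ _ _ Hc) as [HA' HD].
    rewrite dsubst_dsubstl by now rewrite (dinst_length _ _ _ _ Hv).
    specialize (IHv HD f G' Hf HG').
    (* The map is moved inside [rev] and [to_list], so that the instance comes from the mapped
       vector as [dty_cst] expects. *)
    rewrite map_rev, <- Vector.to_list_map in IHv |- *.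
    eapply dty_cst; eauto.
  - intros f G' Hf HG'.
    assert (dwf T (cons (dsubst f A) G')) by (constructor; apply (IHA f); auto).
    eapply dty_pi; [apply (IHA f) | apply (IHB (dup f))]; auto.
  - intros f G' Hf HG'.
    assert (dwf T (cons (dsubst f A) G')) by (constructor; apply (IHA f); auto).
    eapply dty_lam; [apply (IHA f) | apply (IHB (dup f)) | apply IHM]; auto.
  - intros f G' Hf HG'. rewrite dsubst_dsubst1.
    eapply dty_app; [apply (IHM f) | apply (IHN f)]; auto.
  - intros _ f G' _ HG'. now constructor.
  - intros [HA HD] f G' Hf HG'. simpl. constructor; auto.
    rewrite <- dsubst_dsubstl by now rewrite (dinst_length _ _ _ _ Hl).
    auto.
Qed.

Lemma dty_weaken {C : Type} {ar : C -> nat} (T : dtheory ar)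
    (HT : closed_sig T) G M A B :
  dty T G M A -> dwf T (cons B G) -> dty T (cons B G) (dren S M) (dren S A).
Proof.
  intros H HB. rewrite !dren_dsubst_var.
  apply (dty_dsubst_class T HT
    (fun G f G' => forall n A, nth_error G n = Some A ->
      exists k B, f n = dVar k /\ nth_error G' k = Some B /\
        dren (fun m => m + S k) B = dsubst f (dren (fun m => m + S n) A)))
    with G; auto; clear.
  - intros G f G' n A Hf HG' Hn. destruct (Hf _ _ Hn) as [k [B [-> [Hk <-]]]].
    now constructor.
  - intros G f G' A Hf _ [|n] B Hn; simpl in Hn.
    + injection Hn as <-. exists 0, (dsubst f A); split; [|split]; auto.
      now rewrite !dren_shift_1, dsubst_dup_dren.
    + destruct (Hf _ _ Hn) as [k [B' [E [Hk HB]]]]. exists (S k), B'.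
      split; [simpl; now rewrite E | split; auto].
      now rewrite !dren_shift_S, HB, dsubst_dup_dren.
  - intros n A Hn. exists (S n), A; split; [|split]; auto.
    now rewrite dren_shift_S, <- dren_dsubst_var.
Qed.

Lemma dty_dsubst {C : Type} {ar : C -> nat} (T : dtheory ar)
    (HT : closed_sig T) G M A f G' :
  dty T G M A ->
  (forall n B, nth_error G n = Some B ->
     dty T G' (f n) (dsubst f (dren (fun m => m + S n) B))) ->
  dwf T G' -> dty T G' (dsubst f M) (dsubst f A).
Proof.
  intros H Hf HG'. apply (dty_dsubst_class T HT
    (fun G f G' => forall n B, nth_error G n = Some B ->
       dty T G' (f n) (dsubst f (dren (fun m => m + S n) B)))) with G;
    auto; clear - HT.
  intros G f G' A Hf HA [|n] B Hn; simpl in Hn.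
  - injection Hn as <-. rewrite dren_shift_1, dsubst_dup_dren, <- dren_shift_1.
    now constructor.
  - rewrite dren_shift_S, dsubst_dup_dren. apply dty_weaken; auto.
Qed.

Lemma dty_dsubst1 {C : Type} {ar : C -> nat} (T : dtheory ar)
    (HT : closed_sig T) G A N M B :
  dty T (cons A G) M B -> dty T G N A ->
  dty T G (dsubst1 N M) (dsubst1 N B).
Proof.
  intros HM HN. assert (HG := dty_dwf _ _ _ _ HN).
  apply dty_dsubst with (cons A G); auto.
  intros [|n] B' Hn; simpl in Hn.
  - injection Hn as <-. rewrite dren_shift_1. fold (dsubstl (cons N nil) (dren S A)).
    fold (dsubst1 N (dren S A)). now rewrite dsubst1_dren.
  - rewrite dren_shift_S.
    fold (dsubstl (cons N nil) (dren S (dren (fun m => m + S n) B'))).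
    fold (dsubst1 N (dren S (dren (fun m => m + S n) B'))).
    (* The image of variable [S n] involves [n - 0], which reduces to [n] only after a case
       split. *)
    rewrite dsubst1_dren. destruct n; now constructor.
Qed.

(** * The encoding *)

Lemma epts_closed_sig (P : pts_spec) : closed_sig (epts_theory P).
Proof.
  intros c D A H. destruct H; simpl; repeat split; intros f g E; cbn;
    rewrite ?E by lia; reflexivity.
Qed.

(** Writing both sides as replacements in one vector [v] makes the context a function of the
    replaced argument, so conversion can be mapped through it. *)
Lemma dconv_replace {C : Type} {ar : C -> nat} (T : dtheory ar) c
    (v : Vector.t (dterm ar) (ar c)) (i : Fin.t (ar c)) M M' :
  dconv T M M' ->
  dconv T (dCst c (Vector.replace v i M)) (dCst c (Vector.replace v i M')).
Proof.
  apply (clos_rst_map _ _ (fun X => dCst c (Vector.replace v i X))).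
  intros x y H. apply rst_step.
  rewrite <- (Vector.replace_replace_eq _ _ i v x y). constructor.
  now rewrite Vector.nth_replace_eq.
Qed.

Lemma dconv_lam {C : Type} {ar : C -> nat} (T : dtheory ar) A A' M M' :
  dconv T A A' -> dconv T M M' -> dconv T (dLam A M) (dLam A' M').
Proof.
  intros HA HM. apply rst_trans with (dLam A' M).
  - revert HA. apply (clos_rst_map _ _ (fun X => dLam X M)).
    intros; now apply rst_step; constructor.
  - revert HM. apply (clos_rst_map _ _ (fun X => dLam A' X)).
    intros; now apply rst_step; constructor.
Qed.

Lemma dconv_El (P : pts_spec) s A A' :
  dconv (epts_theory P) A A' -> dconv (epts_theory P) (dEl s A) (dEl s A').
Proof. exact (dconv_replace _ (cEl s) [A]%vector Fin.F1 A A'). Qed.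

Lemma dconv_Prod (P : pts_spec) s1 s2 A A' B B' :
  dconv (epts_theory P) A A' -> dconv (epts_theory P) B B' ->
  dconv (epts_theory P) (dProd s1 s2 A B) (dProd s1 s2 A' B').
Proof.
  intros HA HB. eapply rst_trans.
  - exact (dconv_replace _ (cProd s1 s2) [A; B]%vector Fin.F1 _ _ HA).
  - exact (dconv_replace _ (cProd s1 s2) [A'; B]%vector (Fin.FS Fin.F1) _ _ HB).
Qed.

Lemma dconv_abs (P : pts_spec) s1 s2 A A' B B' M M' :
  dconv (epts_theory P) A A' -> dconv (epts_theory P) B B' ->
  dconv (epts_theory P) M M' ->
  dconv (epts_theory P) (dabs s1 s2 A B M) (dabs s1 s2 A' B' M').
Proof.
  intros HA HB HM. eapply rst_trans; [|eapply rst_trans].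
  - exact (dconv_replace _ (cabs s1 s2) [A; B; M]%vector Fin.F1 _ _ HA).
  - exact (dconv_replace _ (cabs s1 s2) [A'; B; M]%vector (Fin.FS Fin.F1) _ _ HB).
  - exact (dconv_replace _ (cabs s1 s2) [A'; B'; M]%vector
             (Fin.FS (Fin.FS Fin.F1)) _ _ HM).
Qed.

Lemma dconv_app (P : pts_spec) s1 s2 A A' B B' M M' N N' :
  dconv (epts_theory P) A A' -> dconv (epts_theory P) B B' ->
  dconv (epts_theory P) M M' -> dconv (epts_theory P) N N' ->
  dconv (epts_theory P) (dapp s1 s2 A B M N) (dapp s1 s2 A' B' M' N').
Proof.
  intros HA HB HM HN. eapply rst_trans; [|eapply rst_trans; [|eapply rst_trans]].
  - exact (dconv_replace _ (capp s1 s2) [A; B; M; N]%vector Fin.F1 _ _ HA).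
  - exact (dconv_replace _ (capp s1 s2) [A'; B; M; N]%vector
             (Fin.FS Fin.F1) _ _ HB).
  - exact (dconv_replace _ (capp s1 s2) [A'; B'; M; N]%vector
             (Fin.FS (Fin.FS Fin.F1)) _ _ HM).
  - exact (dconv_replace _ (capp s1 s2) [A'; B'; M'; N]%vector
             (Fin.FS (Fin.FS (Fin.FS Fin.F1))) _ _ HN).
Qed.

Lemma dconv_El_u (P : pts_spec) s1 s2 :
  axm P s1 s2 -> dconv (epts_theory P) (dEl s2 (du s1)) (dU s1).
Proof.
  intros H. apply rst_step.
  exact (dred_rule (epts_theory P) _ _ dVar (rule_El P _ _ H)).
Qed.

Lemma dred_app_abs (P : pts_spec) s1 s2 s3 A B A' B' M N :
  rul P s1 s2 s3 ->
  dred (epts_theory P) (dapp s1 s2 A B (dabs s1 s2 A' B' M) N) (dApp M N).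
Proof.
  intros H.
  exact (dred_rule (epts_theory P) _ _
    (* Values for the pattern variables 0 to 5, in the order of the rule; the default is reached
       only beyond them. *)
    (fun n => nth n (A :: B :: A' :: B' :: M :: N :: nil)%list (dVar 0))
    (rule_app P _ _ _ H)).
Qed.

(** * The translation, substitution and conversion *)

Lemma tr_eren {S : Type} (M : eterm S) :
  forall r, tr (eren r M) = dren r (tr M).
Proof.
  induction M; intros r; simpl; rewrite ?IHM1, ?IHM2, ?IHM3, ?IHM4; reflexivity.
Qed.

Lemma tr_esubst {S : Type} (M : eterm S) :
  forall f g, (forall n, tr (f n) = g n) -> tr (esubst f M) = dsubst g (tr M).
Proof.
  assert (U : forall (f : nat -> eterm S) g, (forall n, tr (f n) = g n) ->
    forall n, tr (eup f n) = dup g n).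
  { intros f g H [|n]; simpl; auto. now rewrite tr_eren, H. }
  induction M; intros f g H; simpl; auto;
    erewrite ?IHM1, ?IHM2, ?IHM3, ?IHM4 by eauto; reflexivity.
Qed.

Lemma tr_esubst1 {S : Type} (N M : eterm S) :
  tr (esubst1 N M) = dsubst1 (tr N) (tr M).
Proof.
  rewrite dsubst1_dsubst. apply tr_esubst. now intros [|n].
Qed.

Lemma tr_econv (P : pts_spec) M M' :
  econv P M M' -> dconv (epts_theory P) (tr M) (tr M').
Proof.
  apply clos_rst_map. clear.
  induction 1; simpl;
    try (repeat first [assumption | apply dconv_Prod | apply dconv_abs
      | apply dconv_app | apply dconv_lam | apply dconv_El | apply rst_refl]; fail).
  (* One EPTS contraction becomes two Dedukti steps: the rewrite rule exposes an applied
     abstraction, and beta performs the substitution. *)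
  eapply rst_trans; apply rst_step.
  - eapply dred_app_abs; eassumption.
  - rewrite tr_esubst1. constructor.
Qed.

(** * Derived typing rules for the constants of the encoding *)

Lemma dty_U (P : pts_spec) D s :
  dwf (epts_theory P) D -> dty (epts_theory P) D (dU s) (dSort TYPE).
Proof.
  intros HD.
  exact (dty_cst (epts_theory P) D (cU s) []%vector nil (dSort TYPE) KIND
    (sig_U P s) (dty_sort _ _ (dwf_nil _)) (dinst_nil _ _ HD)).
Qed.

Lemma dwf_U (P : pts_spec) s : dwf (epts_theory P) (dU s :: nil)%list.
Proof. apply dwf_cons, dty_U, dwf_nil. Qed.

Lemma dty_El (P : pts_spec) D s A :
  dty (epts_theory P) D A (dU s) ->
  dty (epts_theory P) D (dEl s A) (dSort TYPE).
Proof.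
  intros HA. assert (HD := dty_dwf _ _ _ _ HA).
  refine (dty_cst (epts_theory P) D (cEl s) [A]%vector _ (dSort TYPE) KIND
    (sig_El P s) (dty_sort _ _ (dwf_U _ _)) _).
  apply dinst_cons; [now apply dinst_nil | exact HA].
Qed.

Lemma dty_u (P : pts_spec) D s1 s2 :
  axm P s1 s2 -> dwf (epts_theory P) D ->
  dty (epts_theory P) D (du s1) (dU s2).
Proof.
  intros Hs HD.
  exact (dty_cst (epts_theory P) D (cu s1) []%vector nil (dU s2) TYPE
    (sig_u P s1 s2 Hs) (dty_U _ _ _ (dwf_nil _)) (dinst_nil _ _ HD)).
Qed.

Lemma dty_arrow (P : pts_spec) D s1 s2 A :
  dty (epts_theory P) D A (dU s1) ->
  dty (epts_theory P) D (dPi (dEl s1 A) (dU s2)) (dSort TYPE).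
Proof.
  intros HA. apply dty_pi; [now apply dty_El | apply dty_U, dwf_cons].
  now apply dty_El.
Qed.

Lemma dwf_Prod (P : pts_spec) s1 s2 :
  dwf (epts_theory P) (dPi (dEl s1 (dVar 0)) (dU s2) :: dU s1 :: nil)%list.
Proof.
  apply dwf_cons, dty_arrow.
  exact (dty_var (epts_theory P) _ 0 _ (dwf_U P s1) eq_refl).
Qed.

Lemma dinst_Prod (P : pts_spec) D s1 s2 A B :
  dty (epts_theory P) D A (dU s1) ->
  dty (epts_theory P) D B (dPi (dEl s1 A) (dU s2)) ->
  dinst (epts_theory P) D (B :: A :: nil)%list
    (dPi (dEl s1 (dVar 0)) (dU s2) :: dU s1 :: nil)%list.
Proof.
  intros HA HB. assert (HD := dty_dwf _ _ _ _ HA).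
  apply dinst_cons; [|exact HB].
  apply dinst_cons; [now apply dinst_nil | exact HA].
Qed.

Lemma dty_Prod (P : pts_spec) D s1 s2 s3 A B :
  rul P s1 s2 s3 ->
  dty (epts_theory P) D A (dU s1) ->
  dty (epts_theory P) D B (dPi (dEl s1 A) (dU s2)) ->
  dty (epts_theory P) D (dProd s1 s2 A B) (dU s3).
Proof.
  intros Hr HA HB.
  exact (dty_cst (epts_theory P) D (cProd s1 s2) [A; B]%vector _ (dU s3) TYPE
    (sig_Prod P _ _ _ Hr) (dty_U _ _ _ (dwf_Prod _ _ _))
    (dinst_Prod _ _ _ _ _ _ HA HB)).
Qed.

Lemma dty_El_app (P : pts_spec) D s1 s2 A B N :
  dty (epts_theory P) D B (dPi (dEl s1 A) (dU s2)) ->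
  dty (epts_theory P) D N (dEl s1 A) ->
  dty (epts_theory P) D (dEl s2 (dApp B N)) (dSort TYPE).
Proof.
  intros HB HN. apply dty_El. exact (dty_app (epts_theory P) _ _ _ _ _ HB HN).
Qed.

Lemma dty_abs (P : pts_spec) D s1 s2 s3 A B M :
  rul P s1 s2 s3 ->
  dty (epts_theory P) D A (dU s1) ->
  dty (epts_theory P) D B (dPi (dEl s1 A) (dU s2)) ->
  dty (epts_theory P) D M
    (dPi (dEl s1 A) (dEl s2 (dApp (dren S B) (dVar 0)))) ->
  dty (epts_theory P) D (dabs s1 s2 A B M) (dEl s3 (dProd s1 s2 A B)).
Proof.
  intros Hr HA HB HM.
  (* [H1] extends the parameters [A], [B] by the bound variable of the type of [M], to type the
     codomain of that product; [H2] is the parameter context itself. *)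
  assert (H1 : dwf (epts_theory P)
    (dEl s1 (dVar 1) :: dPi (dEl s1 (dVar 0)) (dU s2) :: dU s1 :: nil)%list).
  { apply dwf_cons, dty_El.
    exact (dty_var (epts_theory P) _ 1 _ (dwf_Prod P s1 s2) eq_refl). }
  assert (H2 : dwf (epts_theory P)
    (dPi (dEl s1 (dVar 1)) (dEl s2 (dApp (dVar 1) (dVar 0)))
       :: dPi (dEl s1 (dVar 0)) (dU s2) :: dU s1 :: nil)%list).
  { apply dwf_cons, dty_pi.
    - now inversion H1.
    - apply (dty_El_app _ _ s1 s2 (dVar 2)).
      + exact (dty_var (epts_theory P) _ 1 _ H1 eq_refl).
      + exact (dty_var (epts_theory P) _ 0 _ H1 eq_refl). }
  refine (dty_cst (epts_theory P) D (cabs s1 s2) [A; B; M]%vector _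
    (dEl s3 (dProd s1 s2 (dVar 2) (dVar 1))) TYPE (sig_abs P _ _ _ Hr) _ _).
  - apply dty_El. apply dty_Prod; auto.
    + exact (dty_var (epts_theory P) _ 2 _ H2 eq_refl).
    + exact (dty_var (epts_theory P) _ 1 _ H2 eq_refl).
  - apply dinst_cons; [exact (dinst_Prod _ _ _ _ _ _ HA HB) | exact HM].
Qed.

Lemma dty_capp (P : pts_spec) D s1 s2 s3 A B M N :
  rul P s1 s2 s3 ->
  dty (epts_theory P) D A (dU s1) ->
  dty (epts_theory P) D B (dPi (dEl s1 A) (dU s2)) ->
  dty (epts_theory P) D M (dEl s3 (dProd s1 s2 A B)) ->
  dty (epts_theory P) D N (dEl s1 A) ->
  dty (epts_theory P) D (dapp s1 s2 A B M N) (dEl s2 (dApp B N)).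
Proof.
  intros Hr HA HB HM HN.
  assert (H1 : dwf (epts_theory P)
    (dEl s3 (dProd s1 s2 (dVar 1) (dVar 0))
       :: dPi (dEl s1 (dVar 0)) (dU s2) :: dU s1 :: nil)%list).
  { apply dwf_cons, dty_El, dty_Prod; auto.
    - exact (dty_var (epts_theory P) _ 1 _ (dwf_Prod P s1 s2) eq_refl).
    - exact (dty_var (epts_theory P) _ 0 _ (dwf_Prod P s1 s2) eq_refl). }
  assert (H2 : dwf (epts_theory P)
    (dEl s1 (dVar 2) :: dEl s3 (dProd s1 s2 (dVar 1) (dVar 0))
       :: dPi (dEl s1 (dVar 0)) (dU s2) :: dU s1 :: nil)%list).
  { apply dwf_cons, dty_El.
    exact (dty_var (epts_theory P) _ 2 _ H1 eq_refl). }
  refine (dty_cst (epts_theory P) D (capp s1 s2) [A; B; M; N]%vector _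
    (dEl s2 (dApp (dVar 2) (dVar 0))) TYPE (sig_app P _ _ _ Hr) _ _).
  - apply (dty_El_app _ _ s1 s2 (dVar 3)).
    + exact (dty_var (epts_theory P) _ 2 _ H2 eq_refl).
    + exact (dty_var (epts_theory P) _ 0 _ H2 eq_refl).
  - apply dinst_cons; [|exact HN].
    apply dinst_cons; [exact (dinst_Prod _ _ _ _ _ _ HA HB) | exact HM].
Qed.

Lemma dty_U_El (P : pts_spec) D M s s' :
  axm P s s' -> dty (epts_theory P) D M (dU s) ->
  dty (epts_theory P) D M (dEl s' (du s)).
Proof.
  intros Hs HM. assert (HD := dty_dwf _ _ _ _ HM).
  eapply dty_conv; [exact HM | now apply dty_El, dty_u |].
  now apply rst_sym, dconv_El_u.
Qed.

Lemma dty_El_U (P : pts_spec) D M s s' :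
  axm P s s' -> dty (epts_theory P) D M (dEl s' (du s)) ->
  dty (epts_theory P) D M (dU s).
Proof.
  intros Hs HM. assert (HD := dty_dwf _ _ _ _ HM).
  eapply dty_conv; [exact HM | now apply dty_U | now apply dconv_El_u].
Qed.

(** * Translated contexts *)

(** The sort recorded at the declaration of a variable is carried to the whole context by weakening,
    where uniqueness can compare it with any other sort of the type. *)
Lemma tr_ctx_nth (P : pts_spec) G D n A :
  tr_ctx P G D -> nth_error G n = Some A ->
  exists s, nth_error D n = Some (dEl s (tr A)) /\
    ety P G (eren (fun m => m + S n) A) (eSort s).
Proof.
  intros HD; revert n A. induction HD as [|G D C s HD IH HC];
    intros [|n] A Hn; try discriminate; simpl in Hn.
  - injection Hn as <-. exists s; split; auto. rewrite eren_shift_1.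
    apply (ety_weaken _ _ _ _ _ HC). now apply ewf_cons with s.
  - destruct (IH _ _ Hn) as [s' [Hn' Hs']]. exists s'; split; auto.
    rewrite eren_shift_S.
    apply (ety_weaken _ _ _ _ _ Hs'). now apply ewf_cons with s.
Qed.

Lemma tr_ctx_exists (P : pts_spec) G : ewf P G -> exists D, tr_ctx P G D.
Proof.
  induction G as [|A G IH]; intros HG.
  - exists nil; constructor.
  - inversion HG as [|? ? s HA]; subst.
    destruct (IH (ety_ewf _ _ _ _ HA)) as [D HD].
    eexists; econstructor; eassumption.
Qed.

Lemma tr_ctx_unique (P : pts_spec) (HP : functional_pts P) G D D' :
  tr_ctx P G D -> tr_ctx P G D' -> D = D'.
Proof.
  intros HD; revert D'. induction HD as [|G D A s HD IH HA]; intros D' HD';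
    inversion HD' as [|? D'' ? s' HD'' HA']; subst; auto.
  now rewrite (ety_unique_sort P HP _ _ _ _ HA HA'), (IH _ HD'').
Qed.

(* Preservation of typing *)
Scheme ety_ewf_ind := Minimality for ety Sort Prop
  with ewf_ety_ind := Minimality for ewf Sort Prop.

Combined Scheme ety_ewf_mutind from ety_ewf_ind, ewf_ety_ind.

(* The sort [s] need not be a top-sort in the first clause: for a sort that is
   not one, both clauses apply and their types [U_s] and [El_{s'} u_s] are
   convertible. *)
Definition tr_typed (P : pts_spec) (G : ectx P) (M A : eterm (sort P)) : Prop :=
  forall D, tr_ctx P G D ->
    (forall s, A = eSort s -> dty (epts_theory P) D (tr M) (dU s)) /\
    (forall s, ety P G A (eSort s) ->
       dty (epts_theory P) D (tr M) (dEl s (tr A))).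

(** The [El] clause follows from the [U] clause: any type of the sort [s] that is a sort comes from
    an axiom, along which [U] expands. *)
Lemma tr_typed_sort (P : pts_spec) (G : ectx P) M s :
  (forall D, tr_ctx P G D -> dty (epts_theory P) D (tr M) (dU s)) ->
  tr_typed P G M (eSort s).
Proof.
  intros H D HD; split.
  - intros s' E; injection E as <-; auto.
  - intros s' Hs'. apply dty_U_El; auto. now apply ety_sort_axm with G.
Qed.

(** A single sort of [A] is enough by uniqueness; if [A] is itself a sort, an axiom turns [El] back
    into [U]. *)
Lemma tr_typed_El (P : pts_spec) (HP : functional_pts P) (G : ectx P) M A s :
  ety P G A (eSort s) ->
  (forall D, tr_ctx P G D -> dty (epts_theory P) D (tr M) (dEl s (tr A))) ->
  tr_typed P G M A.
Proof.
  intros HA H D HD; split.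
  - intros s' ->. apply dty_El_U with s; auto. now apply ety_sort_axm with G.
  - intros s' Hs'. rewrite <- (ety_unique_sort P HP _ _ _ _ HA Hs'); auto.
Qed.

(** Shared by product, abstraction and application, all of which pass the codomain to their constant
    as a function. *)
Lemma tr_family (P : pts_spec) (G : ectx P) D s1 s2 A B :
  tr_ctx P G D -> ety P G A (eSort s1) ->
  tr_typed P G A (eSort s1) -> tr_typed P (cons A G) B (eSort s2) ->
  dty (epts_theory P) D (tr A) (dU s1) /\
  dty (epts_theory P) (cons (dEl s1 (tr A)) D) (tr B) (dU s2) /\
  dty (epts_theory P) D (dLam (dEl s1 (tr A)) (tr B))
    (dPi (dEl s1 (tr A)) (dU s2)).
Proof.
  intros HD HA IHA IHB.
  assert (HA' := proj1 (IHA D HD) _ eq_refl).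
  assert (HB' := proj1 (IHB _ (tr_cons _ _ _ _ _ HD HA)) _ eq_refl).
  repeat split; auto.
  apply dty_lam with TYPE; auto using dty_El.
  now apply dty_U, dty_dwf with (tr B) (dU s2).
Qed.

Lemma tr_preserves_typing (P : pts_spec) (HP : functional_pts P) :
  (forall G M A, ety P G M A -> tr_typed P G M A) /\
  (forall G, ewf P G -> forall D, tr_ctx P G D -> dwf (epts_theory P) D).
Proof.
  apply ety_ewf_mutind.
  - intros G M A B s HM IHM HB IHB HAB.
    apply (tr_typed_El P HP _ _ _ _ HB). intros D HD.
    assert (HB' := dty_El _ _ _ _ (proj1 (IHB D HD) _ eq_refl)).
    apply dty_conv with (dEl s (tr A)) TYPE; auto.
    + apply IHM; auto.
      destruct (ety_type_correct _ _ _ _ HM) as [[t ->] | [t Ht]].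
      * apply rst_sym, econv_sort_epars in HAB.
        exact (subject_reduction_epars _ _ _ _ _ HAB HB).
      * now rewrite <- (ety_econv_sort P HP _ _ _ _ _ HAB Ht HB).
    + now apply dconv_El, tr_econv.
  - intros G s1 s2 _ IHG Hs. apply tr_typed_sort. intros D HD.
    apply dty_u; auto.
  - intros G n A HG IHG Hn. destruct (ewf_nth _ _ _ _ HG Hn) as [s Hs].
    apply (tr_typed_El P HP _ _ _ _ Hs). intros D HD.
    destruct (tr_ctx_nth _ _ _ _ _ HD Hn) as [s' [Hn' Hs']].
    rewrite (ety_unique_sort P HP _ _ _ _ Hs Hs'), tr_eren.
    exact (dty_var (epts_theory P) D n _ (IHG D HD) Hn').
  - intros G s1 s2 s3 A B Hr HA IHA HB IHB. apply tr_typed_sort. intros D HD.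
    destruct (tr_family _ _ _ _ _ _ _ HD HA IHA IHB) as [HA' [_ HB']].
    now apply dty_Prod.
  - intros G s1 s2 s3 A B M Hr HA IHA HB IHB HM IHM.
    apply (tr_typed_El P HP _ _ _ s3 (ety_pi _ _ _ _ _ _ _ Hr HA HB)).
    intros D HD.
    destruct (tr_family _ _ _ _ _ _ _ HD HA IHA IHB) as [HA' [HB' HF]].
    assert (HM' := proj2 (IHM _ (tr_cons _ _ _ _ _ HD HA)) _ HB).
    apply dty_abs; auto.
    assert (HE : dty (epts_theory P) (cons (dEl s1 (tr A)) D)
      (dEl s2 (dApp (dren S (dLam (dEl s1 (tr A)) (tr B))) (dVar 0)))
      (dSort TYPE)).
    { assert (HD' := dty_dwf _ _ _ _ HM').
      apply (dty_El_app _ _ s1 s2 (dren S (tr A))).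
      - exact (dty_weaken _ (epts_closed_sig P) _ _ _ _ HF HD').
      - assert (HV := dty_var (epts_theory P) _ 0 _ HD' eq_refl).
        rewrite dren_shift_1 in HV. exact HV. }
    apply dty_lam with TYPE; auto using dty_El.
    eapply dty_conv; [exact HM' | exact HE |].
    apply dconv_El, rst_sym, rst_step.
    (* Weakening the family renames its body by [upren S]; contracting it at variable 0 undoes this
       renaming and returns [tr B]. *)
    assert (Hb := dred_beta (epts_theory P) (dren S (dEl s1 (tr A)))
      (dren (upren S) (tr B)) (dVar 0)).
    rewrite dsubst1_var_dren in Hb. exact Hb.
  - intros G s1 s2 s3 A B M N Hr HA IHA HB IHB HN IHN HM IHM.
    apply (tr_typed_El P HP _ _ _ s2 (ety_esubst1 _ _ _ _ _ _ HB HN)).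
    intros D HD.
    destruct (tr_family _ _ _ _ _ _ _ HD HA IHA IHB) as [HA' [HB' HF]].
    assert (HN' := proj2 (IHN D HD) _ HA).
    assert (HM' := proj2 (IHM D HD) _ (ety_pi _ _ _ _ _ _ _ Hr HA HB)).
    rewrite tr_esubst1. eapply dty_conv.
    + apply (dty_capp _ _ _ _ _ _ _ _ _ Hr HA' HF HM' HN').
    + apply dty_El.
      exact (dty_dsubst1 _ (epts_closed_sig P) _ _ _ _ _ HB' HN').
    + apply dconv_El, rst_step. apply dred_beta.
  - intros D HD. inversion HD. constructor.
  - intros G A s HA IHA D HD. inversion HD as [|? D' ? s' HD' HA']; subst.
    apply dwf_cons, dty_El. apply (IHA D' HD').
    now rewrite (ety_unique_sort P HP _ _ _ _ HA HA').
Qed.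

(** The translated context and the sort of [A] are given by relations, so each is stated by unique
    existence. *)
Theorem mainTheorem2 (P : pts_spec) (HP : functional_pts P)
    (G : ectx P) (M A : eterm (sort P)) :
  (ewf P G ->
     exists D, unique (tr_ctx P G) D /\ dwf (epts_theory P) D)
  /\
  (ety P G M A ->
     exists D, unique (tr_ctx P G) D /\
       (forall s, A = eSort s -> top_sort P s ->
          dty (epts_theory P) D (tr M) (dU s)) /\
       (~ (exists s, A = eSort s /\ top_sort P s) ->
          exists sA, unique (fun s => ety P G A (eSort s)) sA /\
            dty (epts_theory P) D (tr M) (dEl sA (tr A)))).
Proof.
  destruct (tr_preserves_typing P HP) as [Hty Hwf].
  assert (HU : ewf P G -> exists D, unique (tr_ctx P G) D).
  { intros HG. destruct (tr_ctx_exists _ _ HG) as [D HD].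
    exists D; split; auto. intros D'. now apply tr_ctx_unique. }
  split.
  - intros HG. destruct (HU HG) as [D HD]. exists D; split; auto.
    apply (Hwf G); auto. apply HD.
  - intros HM. assert (HG := ety_ewf _ _ _ _ HM).
    destruct (HU HG) as [D HD]. exists D; split; auto.
    destruct (Hty _ _ _ HM D (proj1 HD)) as [H1 H2]. split; auto.
    intros Htop.
    assert (exists s, ety P G A (eSort s)) as [s Hs].
    { destruct (ety_type_correct _ _ _ _ HM) as [[s ->] | ?]; auto.
      (* Not being a top-sort is a negative fact; excluded middle extracts from it an actual axiom
         for [s]. *)
      destruct (classic (exists s', axm P s s')) as [[s' Hs'] | Hs'].
      - exists s'. now constructor.
      - exfalso. apply Htop. now exists s. }
    exists s; repeat split; auto.
    intros s'. now apply ety_unique_sort.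
Qed.
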